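(* For any quasi-category $A$, the exponential $A^{\mathbf 2}=A^{\Delta^1}$ is a weak cotensor of $A$ by the generic arrow category $\mathbf 2$ in $\mathrm{qCat}_2$. That is, for every quasi-category $X$ the canonical functor $$\hom'(X,A^{\mathbf 2})\longrightarrow\hom'(X,A)^{\mathbf 2}$$ is a smothering functor.
   Context: A quasi-category is a simplicial set with fillers for all inner horns; functors are simplicial maps between quasi-categories. $\mathrm{qCat}_2$ is the strict 2-category of quasi-categories with hom-categories $\hom'(A,B)=h(B^A)$, where $B^A$ is the internal hom of simplicial sets and $h\colon\mathrm{sSet}\to\mathrm{Cat}$ is left adjoint to the nerve. $\mathbf 2$ is the category $\bullet\to\bullet$, whose nerve is $\Delta^1$. $\mathcal C^{\mathbf 2}$ denotes the arrow category of a category $\mathcal C$. The canonical functor is induced by composition with the 2-cell $p_0\Rightarrow p_1\colon A^{\Delta^1}\to A$ (from domain evaluation to codomain evaluation) represented by the evaluation map $A^{\Delta^1}\times\Delta^1\to A$. A functor between categories is smothering if it is surjective on objects, full, and conservative (reflects isomorphisms). *)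

(* Defs.v *)
From HB Require Import structures.
From mathcomp Require Import all_boot generic_quotient.
From mathcomp Require Import boolp.

Set Implicit Arguments.
Unset Strict Implicit.
Unset Printing Implicit Defensive.

Local Open Scope quotient_scope.

(* Composition is written in diagrammatic order: [f ;; g] is "f, then g". *)
Record category := Category {
  ob :> Type;
  hom : ob -> ob -> Type;
  idm : forall x, hom x x;
  compm : forall x y z, hom x y -> hom y z -> hom x z;
  compm1l : forall x y (f : hom x y), compm (idm x) f = f;
  compm1r : forall x y (f : hom x y), compm f (idm y) = f;
  compmA : forall x y z t (f : hom x y) (g : hom y z) (h : hom z t),
    compm f (compm g h) = compm (compm f g) h }.
Arguments hom {c} x y.
Arguments idm {c} x.
Arguments compm {c x y z} f g.

Notation "f ;; g" := (compm f g) (at level 50, left associativity).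

Record functor (C D : category) := Functor {
  fobj :> C -> D;
  fhom : forall x y, hom x y -> hom (fobj x) (fobj y);
  fhom1 : forall x, fhom (idm x) = idm (fobj x);
  fhomM : forall x y z (f : hom x y) (g : hom y z),
    fhom (f ;; g) = fhom f ;; fhom g }.
Arguments fhom {C D} F {x y} f : rename.

Definition isom (C : category) (x y : C) (f : hom x y) : Prop :=
  exists g : hom y x, f ;; g = idm x /\ g ;; f = idm y.

Definition surjective_on_objects (C D : category) (F : functor C D) : Prop :=
  forall y : D, exists x : C, F x = y.

Definition full (C D : category) (F : functor C D) : Prop :=
  forall (x y : C) (g : hom (F x) (F y)), exists f : hom x y, fhom F f = g.

Definition conservative (C D : category) (F : functor C D) : Prop :=
  forall (x y : C) (f : hom x y), isom (fhom F f) -> isom f.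

Definition smothering (C D : category) (F : functor C D) : Prop :=
  [/\ surjective_on_objects F, full F & conservative F].

Program Definition fcomp (C D E : category) (G : functor D E)
    (F : functor C D) : functor C E :=
  @Functor C E (fun x => G (F x)) (fun x y f => fhom G (fhom F f)) _ _.
Next Obligation. by rewrite !fhom1. Qed.
Next Obligation. by rewrite !fhomM. Qed.

Program Definition prod_cat (C D : category) : category :=
  @Category (C * D)%type
    (fun x y => (hom x.1 y.1 * hom x.2 y.2)%type)
    (fun x => (idm x.1, idm x.2))
    (fun x y z f g => (f.1 ;; g.1, f.2 ;; g.2)) _ _ _.
Next Obligation. by rewrite /= !compm1l. Qed.
Next Obligation. by rewrite /= !compm1r. Qed.
Next Obligation. by rewrite /= !compmA. Qed.

Record arrow (C : category) :=
  Arrow { adom : C; acod : C; amor : hom adom acod }.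
Arguments Arrow {C adom acod} amor.

Record square (C : category) (f g : arrow C) := Square {
  sqdom : hom (adom f) (adom g);
  sqcod : hom (acod f) (acod g);
  sqE : amor f ;; sqcod = sqdom ;; amor g }.
Arguments Square {C f g} sqdom sqcod sqE.

Lemma square_eq (C : category) (f g : arrow C) (s t : square f g) :
  sqdom s = sqdom t -> sqcod s = sqcod t -> s = t.
Proof.
case: s t => [a b e] [a' b' e'] /= Ea Eb; subst a' b'.
by rewrite (Prop_irrelevance e e').
Qed.

Program Definition arrow_cat (C : category) : category :=
  @Category (arrow C) (@square C)
    (fun f => Square (idm (adom f)) (idm (acod f)) _)
    (fun f g h s t => Square (sqdom s ;; sqdom t) (sqcod s ;; sqcod t) _)
    _ _ _.
Next Obligation. by rewrite compm1l compm1r. Qed.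
Next Obligation. by rewrite compmA sqE -compmA sqE compmA. Qed.
Next Obligation. by apply: square_eq; rewrite /= compm1l. Qed.
Next Obligation. by apply: square_eq; rewrite /= compm1r. Qed.
Next Obligation. by apply: square_eq; rewrite /= compmA. Qed.

(* Delta(m, n): the monotone maps [m] -> [n], where [n] = {0, ..., n} is
   'I_n.+1. *)
Definition monotone m n (f : {ffun 'I_m.+1 -> 'I_n.+1}) : bool :=
  [forall i : 'I_m.+1, forall j : 'I_m.+1, (i <= j) ==> (f i <= f j)].

Definition ordmap (m n : nat) : Type :=
  {f : {ffun 'I_m.+1 -> 'I_n.+1} | monotone f}.

Definition ordmap_fun m n (f : ordmap m n) : 'I_m.+1 -> 'I_n.+1 := val f.
Coercion ordmap_fun : ordmap >-> Funclass.

Lemma ordmap_eq m n (f g : ordmap m n) : f =1 g -> f = g.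
Proof. by move=> E; apply: val_inj; apply/ffunP. Qed.

Lemma ordmap_homo m n (f : ordmap m n) (i j : 'I_m.+1) :
  i <= j -> f i <= f j.
Proof. by move/forallP: (valP f) => /(_ i)/forallP/(_ j)/implyP; apply. Qed.

Lemma mk_subproof m n (f : 'I_m.+1 -> 'I_n.+1) :
  (forall i j : 'I_m.+1, i <= j -> f i <= f j) -> monotone (finfun f).
Proof.
by move=> H; apply/forallP => i; apply/forallP => j; apply/implyP => ij;
  rewrite !ffunE; apply: H.
Qed.

Definition mk_ordmap m n (f : 'I_m.+1 -> 'I_n.+1)
    (H : forall i j : 'I_m.+1, i <= j -> f i <= f j) : ordmap m n :=
  exist _ (finfun f) (mk_subproof H).

Lemma mk_ordmapE m n (f : 'I_m.+1 -> 'I_n.+1) H i : @mk_ordmap m n f H i = f i.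
Proof. exact: ffunE. Qed.

Definition oid n : ordmap n n := @mk_ordmap n n id (fun _ _ h => h).

Definition ocomp m n p (g : ordmap n p) (f : ordmap m n) : ordmap m p :=
  @mk_ordmap m p (fun i => g (f i))
    (fun _ _ h => ordmap_homo g (ordmap_homo f h)).

Definition oconst m n (i : 'I_n.+1) : ordmap m n :=
  @mk_ordmap m n (fun _ => i) (fun _ _ _ => leqnn i).

Lemma coface_subproof n (i : 'I_n.+2) (j k : 'I_n.+1) :
  j <= k -> lift i j <= lift i k.
Proof. by rewrite /= leq_bump2. Qed.

(* The monotone injection [n] -> [n+1] that misses i. *)
Definition coface n (i : 'I_n.+2) : ordmap n n.+1 :=
  mk_ordmap (@coface_subproof n i).

Lemma ocompE m n p (g : ordmap n p) (f : ordmap m n) i :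
  ocomp g f i = g (f i).
Proof. exact: mk_ordmapE. Qed.
Lemma oidE n i : oid n i = i. Proof. exact: mk_ordmapE. Qed.
Lemma oconstE m n (i : 'I_n.+1) j : oconst m i j = i.
Proof. exact: mk_ordmapE. Qed.
Lemma cofaceE n (i : 'I_n.+2) j : coface i j = lift i j.
Proof. exact: mk_ordmapE. Qed.

Lemma ocomp1l m n (f : ordmap m n) : ocomp (oid n) f = f.
Proof. by apply: ordmap_eq => i; rewrite ocompE oidE. Qed.
Lemma ocomp1r m n (f : ordmap m n) : ocomp f (oid m) = f.
Proof. by apply: ordmap_eq => i; rewrite ocompE oidE. Qed.
Lemma ocompA m n p q (h : ordmap p q) (g : ordmap n p) (f : ordmap m n) :
  ocomp h (ocomp g f) = ocomp (ocomp h g) f.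
Proof. by apply: ordmap_eq => i; rewrite !ocompE. Qed.
Lemma ocomp_constl m n p (i : 'I_p.+1) (f : ordmap m n) :
  ocomp (oconst n i) f = oconst m i.
Proof. by apply: ordmap_eq => j; rewrite ocompE !oconstE. Qed.
Lemma ocomp_constr m n p (g : ordmap n p) (i : 'I_n.+1) :
  ocomp g (oconst m i) = oconst m (g i).
Proof. by apply: ordmap_eq => j; rewrite ocompE !oconstE. Qed.

(* A presheaf on Delta; [act f] is the contravariant action of f. *)
Record sset := SSet {
  simp :> nat -> Type;
  act : forall m n, ordmap m n -> simp n -> simp m;
  act1 : forall n (x : simp n), act (oid n) x = x;
  actM : forall m n p (g : ordmap n p) (f : ordmap m n) (x : simp p),
    act (ocomp g f) x = act f (act g x) }.
Arguments act {s m n} f x.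

Record smap (X Y : sset) := SMap {
  smap_fun :> forall n, X n -> Y n;
  smapP : forall m n (f : ordmap m n) (x : X n),
    smap_fun (act f x) = act f (smap_fun x) }.
Arguments smap_fun {X Y} s {n} x.

Lemma smap_eq (X Y : sset) (f g : smap X Y) :
  (forall n (x : X n), f n x = g n x) -> f = g.
Proof.
case: f g => [f Hf] [g Hg] /= E.
have E' : f = g by apply: functional_extensionality_dep => n; apply: funext.
by subst g; rewrite (Prop_irrelevance Hf Hg).
Qed.

Program Definition scomp (X Y Z : sset) (g : smap Y Z) (f : smap X Y) :
  smap X Z := @SMap X Z (fun n x => g n (f n x)) _.
Next Obligation. by rewrite !smapP. Qed.

Program Definition simplex (n : nat) : sset :=
  @SSet (fun m => ordmap m n) (fun l m f s => ocomp s f) _ _.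
Next Obligation. exact: ocomp1r. Qed.
Next Obligation. exact: ocompA. Qed.

(* The horn Lambda^n_k: the simplices of Delta^n that miss some vertex other
   than k. *)
Definition in_horn n (k : 'I_n.+1) m (s : ordmap m n) : bool :=
  [exists i, (i != k) && [forall j, s j != i]].

Lemma horn_subproof n (k : 'I_n.+1) l m (f : ordmap l m) (s : ordmap m n) :
  in_horn k s -> in_horn k (ocomp s f).
Proof.
case/existsP => i /andP[ik /forallP si]; apply/existsP; exists i.
by rewrite ik; apply/forallP => j; rewrite ocompE.
Qed.

Program Definition horn (n : nat) (k : 'I_n.+1) : sset :=
  @SSet (fun m => {s : ordmap m n | in_horn k s})
    (fun l m f s => exist _ (ocomp (val s) f) (horn_subproof f (valP s))) _ _.
Next Obligation. by apply: val_inj; rewrite /= ocomp1r. Qed.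
Next Obligation. by apply: val_inj; rewrite /= ocompA. Qed.

Definition quasicategory (X : sset) : Prop :=
  forall (n : nat) (k : 'I_n.+1), 0 < k < n ->
  forall f : smap (horn k) X,
  exists g : smap (simplex n) X,
  forall m (s : horn k m), g m (val s) = f m s.

Program Definition sprod (X Y : sset) : sset :=
  @SSet (fun n => (X n * Y n)%type)
    (fun m n f x => (act f x.1, act f x.2)) _ _.
Next Obligation. by rewrite /= !act1. Qed.
Next Obligation. by rewrite /= !actM. Qed.

Program Definition ihom_act (X Y : sset) m n (f : ordmap m n)
    (u : smap (sprod X (simplex n)) Y) : smap (sprod X (simplex m)) Y :=
  @SMap (sprod X (simplex m)) Y (fun p x => u p (x.1, ocomp f x.2)) _.
Next Obligation. by rewrite -smapP /= ocompA. Qed.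

(* The internal hom Y^X. *)
Program Definition ihom (X Y : sset) : sset :=
  @SSet (fun n => smap (sprod X (simplex n)) Y) (@ihom_act X Y) _ _.
Next Obligation. by apply: smap_eq => m [a s] /=; rewrite ocomp1l. Qed.
Next Obligation. by apply: smap_eq => q [a s] /=; rewrite ocompA. Qed.

Definition v0 : 'I_2 := ord0.
Definition v1 : 'I_2 := ord_max.

Record edge (X : sset) (x y : X 0) := Edge {
  edge_simp : X 1;
  edge_src : act (oconst 0 v0) edge_simp = x;
  edge_tgt : act (oconst 0 v1) edge_simp = y }.
Arguments Edge {X x y} edge_simp edge_src edge_tgt.

Lemma edge_eq (X : sset) (x y : X 0) (e e' : edge x y) :
  edge_simp e = edge_simp e' -> e = e'.
Proof.
case: e e' => [e s t] [e' s' t'] /= E; subst e'.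
by rewrite (Prop_irrelevance s s') (Prop_irrelevance t t').
Qed.

(* Paths of 1-simplices: the morphisms of the free category on the graph
   X_1 => X_0. *)
Inductive chain (X : sset) : X 0 -> X 0 -> Type :=
| chain_nil (x : X 0) : chain x x
| chain_cons (x y z : X 0) (e : edge x y) (p : chain y z) : chain x z.
Arguments chain_nil {X} x.
Arguments chain_cons {X x y z} e p.

Fixpoint chain_cat (X : sset) (x y z : X 0) (p : chain x y) :
    chain y z -> chain x z :=
  match p in chain a b return chain b z -> chain a z with
  | chain_nil _ => fun q => q
  | chain_cons _ _ _ e p' => fun q => chain_cons e (chain_cat p' q)
  end.

Definition chain1 (X : sset) (x y : X 0) (e : edge x y) : chain x y :=
  chain_cons e (chain_nil y).

Lemma chain_cat_nil (X : sset) (x y : X 0) (p : chain x y) :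
  chain_cat p (chain_nil y) = p.
Proof. by elim: p => //= a b c e p ->. Qed.

Lemma chain_catA (X : sset) (x y z t : X 0) (p : chain x y) (q : chain y z)
  (r : chain z t) : chain_cat p (chain_cat q r) = chain_cat (chain_cat p q) r.
Proof. by elim: p q => //= a b c e p IH q; rewrite IH. Qed.

(* The edges e01, e12, e02 bound the 2-simplex s (faces d_2, d_0, d_1). *)
Definition bounds (X : sset) (x y z : X 0) (s : X 2)
    (e01 : edge x y) (e12 : edge y z) (e02 : edge x z) : Prop :=
  [/\ act (coface (inord 2)) s = edge_simp e01,
      act (coface (inord 0)) s = edge_simp e12
    & act (coface (inord 1)) s = edge_simp e02].

Definition degenerate (X : sset) (x : X 0) (e : edge x x) : Prop :=
  edge_simp e = act (oconst 1 ord0) x.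

(* The congruence that makes degenerate edges identities and makes the long
   edge of each 2-simplex the composite of the two short ones. *)
Inductive chain_equiv (X : sset) :
    forall x y : X 0, chain x y -> chain x y -> Prop :=
| ce_refl x y (p : chain x y) : chain_equiv p p
| ce_sym x y (p q : chain x y) : chain_equiv p q -> chain_equiv q p
| ce_trans x y (p q r : chain x y) :
    chain_equiv p q -> chain_equiv q r -> chain_equiv p r
| ce_cat x y z (p p' : chain x y) (q q' : chain y z) :
    chain_equiv p p' -> chain_equiv q q' ->
    chain_equiv (chain_cat p q) (chain_cat p' q')
| ce_deg x (e : edge x x) : degenerate e ->
    chain_equiv (chain1 e) (chain_nil x)
| ce_tri x y z (s : X 2) (e01 : edge x y) (e12 : edge y z) (e02 : edge x z) :
    bounds s e01 e12 e02 ->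
    chain_equiv (chain_cat (chain1 e01) (chain1 e12)) (chain1 e02).

HB.instance Definition _ (X : sset) (x y : X 0) := gen_eqMixin (chain x y).
HB.instance Definition _ (X : sset) (x y : X 0) := gen_choiceMixin (chain x y).

Definition chain_rel (X : sset) (x y : X 0) : rel (chain x y) :=
  fun p q => `[< chain_equiv p q >].

Lemma chain_relP (X : sset) (x y : X 0) : equiv_class_of (@chain_rel X x y).
Proof.
split=> [p | p q | q p r /asboolP pq /asboolP qr].
- by apply/asboolP; exact: ce_refl.
- by apply/asboolP/asboolP; exact: ce_sym.
- by apply/asboolP; exact: ce_trans qr.
Qed.

Canonical chain_equiv_rel (X : sset) (x y : X 0) :=
  EquivRelPack (@chain_relP X x y).

Definition hhom (X : sset) (x y : X 0) : Type :=
  {eq_quot @chain_equiv_rel X x y}.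

Definition hpi (X : sset) (x y : X 0) (p : chain x y) : hhom x y :=
  \pi_({eq_quot @chain_equiv_rel X x y}) p.

Definition hrepr (X : sset) (x y : X 0) (f : hhom x y) : chain x y :=
  repr (f : {eq_quot @chain_equiv_rel X x y}).

Lemma hreprK (X : sset) (x y : X 0) (f : hhom x y) : hpi (hrepr f) = f.
Proof. exact: (@reprK _ {eq_quot @chain_equiv_rel X x y}). Qed.

Lemma hpiP (X : sset) (x y : X 0) (p q : chain x y) :
  hpi p = hpi q <-> chain_equiv p q.
Proof.
split=> [/(@eqmodP _ (@chain_equiv_rel X x y)) /asboolP // | H].
by apply/(@eqmodP _ (@chain_equiv_rel X x y))/asboolP.
Qed.

Lemma hrepr_pi (X : sset) (x y : X 0) (p : chain x y) :
  chain_equiv (hrepr (hpi p)) p.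
Proof. by apply/hpiP; rewrite hreprK. Qed.

Definition hcompm (X : sset) (x y z : X 0) (f : hhom x y) (g : hhom y z) :
  hhom x z := hpi (chain_cat (hrepr f) (hrepr g)).

Lemma hcompm_pi (X : sset) (x y z : X 0) (p : chain x y) (q : chain y z) :
  hcompm (hpi p) (hpi q) = hpi (chain_cat p q).
Proof. by apply/hpiP/ce_cat; exact: hrepr_pi. Qed.

(* The homotopy category hX; [hcat_adjoint] below shows that h is left adjoint
   to the nerve. *)
Program Definition hcat (X : sset) : category :=
  @Category (X 0) (@hhom X) (fun x => hpi (chain_nil x)) (@hcompm X) _ _ _.
Next Obligation. by rewrite -[f]hreprK hcompm_pi. Qed.
Next Obligation. by rewrite -[f]hreprK hcompm_pi chain_cat_nil. Qed.
Next Obligation.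
by rewrite -[f]hreprK -[g]hreprK -[h]hreprK !hcompm_pi chain_catA.
Qed.

Definition hedge (X : sset) (x y : X 0) (e : edge x y) : @hom (hcat X) x y :=
  hpi (chain1 e).

Lemma hedge_deg (X : sset) (x : X 0) (e : edge x x) :
  degenerate e -> hedge e = idm (x : hcat X).
Proof. by move=> H; apply/hpiP/ce_deg. Qed.

Lemma hedge_tri (X : sset) (x y z : X 0) (s : X 2)
    (e01 : edge x y) (e12 : edge y z) (e02 : edge x z) :
  bounds s e01 e12 e02 -> hedge e01 ;; hedge e12 = hedge e02.
Proof.
by move=> H; rewrite /= /hedge hcompm_pi; apply/hpiP; exact: ce_tri H.
Qed.

Lemma hcat_ind (X : sset) (P : forall x y : hcat X, hom x y -> Prop) :
  (forall x, P x x (idm x)) ->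
  (forall x y z (e : @edge X x y) (f : @hom (hcat X) y z),
     P y z f -> P x z (hedge e ;; f)) ->
  forall x y (f : @hom (hcat X) x y), P x y f.
Proof.
move=> P1 PM x y f; rewrite -[f]hreprK; elim: (hrepr f) => [a | a b c e p IH].
  exact: P1.
by have := PM _ _ _ e _ IH; rewrite /= /hedge hcompm_pi.
Qed.

Section HRec.
Variables (X : sset) (C : category) (F0 : X 0 -> C).
Variable F1 : forall x y : X 0, edge x y -> hom (F0 x) (F0 y).
Hypothesis F1_deg : forall x (e : edge x x), degenerate e -> F1 e = idm (F0 x).
Hypothesis F1_tri : forall x y z (s : X 2)
  (e01 : edge x y) (e12 : edge y z) (e02 : edge x z),
  bounds s e01 e12 e02 -> F1 e01 ;; F1 e12 = F1 e02.

Fixpoint chain_eval (x y : X 0) (p : chain x y) : hom (F0 x) (F0 y) :=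
  match p in chain a b return hom (F0 a) (F0 b) with
  | chain_nil a => idm (F0 a)
  | chain_cons _ _ _ e p' => F1 e ;; chain_eval p'
  end.

Lemma chain_eval_cat x y z (p : chain x y) (q : chain y z) :
  chain_eval (chain_cat p q) = chain_eval p ;; chain_eval q.
Proof.
elim: p q => [a | a b c e p IH] q /=; first by rewrite compm1l.
by rewrite IH compmA.
Qed.

Lemma chain_eval_equiv x y (p q : chain x y) :
  chain_equiv p q -> chain_eval p = chain_eval q.
Proof.
elim=> {x y p q} [//|x y p q _ -> //|x y p q r _ -> _ -> //
  |x y z p p' q q' _ E _ E'|x e He|x y z s e01 e12 e02 H].
- by rewrite !chain_eval_cat E E'.
- by rewrite /= compm1r F1_deg.
- by rewrite /= !compm1r (F1_tri H).
Qed.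

Lemma hrec_pi x y (p : chain x y) : chain_eval (hrepr (hpi p)) = chain_eval p.
Proof. exact/chain_eval_equiv/hrepr_pi. Qed.

(* The functor out of hX given by its values on vertices and edges. *)
Program Definition hrec : functor (hcat X) C :=
  @Functor (hcat X) C F0 (fun x y f => chain_eval (hrepr f)) _ _.
Next Obligation. exact: hrec_pi. Qed.
Next Obligation. by rewrite hrec_pi chain_eval_cat. Qed.

Lemma hrec_edge x y (e : edge x y) : fhom hrec (hedge e) = F1 e.
Proof. by rewrite /= hrec_pi /= compm1r. Qed.

End HRec.

Program Definition smap_edge (X Y : sset) (f : smap X Y) (x y : X 0)
    (e : edge x y) : edge (f 0 x) (f 0 y) := Edge (f 1 (edge_simp e)) _ _.
Next Obligation. by rewrite -smapP edge_src. Qed.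
Next Obligation. by rewrite -smapP edge_tgt. Qed.

Lemma hmap_deg (X Y : sset) (f : smap X Y) (x : X 0) (e : edge x x) :
  degenerate e -> hedge (smap_edge f e) = idm (f 0 x : hcat Y).
Proof. by move=> H; apply: hedge_deg; rewrite /degenerate /= H smapP. Qed.

Lemma hmap_tri (X Y : sset) (f : smap X Y) (x y z : X 0) (s : X 2)
    (e01 : edge x y) (e12 : edge y z) (e02 : edge x z) :
  bounds s e01 e12 e02 ->
  hedge (smap_edge f e01) ;; hedge (smap_edge f e12) = hedge (smap_edge f e02).
Proof.
case=> H2 H0 H1; apply: (@hedge_tri _ _ _ _ (f 2 s)).
by split; rewrite -smapP /= ?H2 ?H0 ?H1.
Qed.

Definition hmap (X Y : sset) (f : smap X Y) : functor (hcat X) (hcat Y) :=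
  hrec (@hmap_deg X Y f) (@hmap_tri X Y f).

Lemma degen_subproof (X : sset) (x : X 0) (i : 'I_2) :
  act (oconst 0 i) (act (oconst 1 ord0) x) = x.
Proof.
rewrite -actM ocomp_constl -[RHS]act1; congr act.
by apply: ordmap_eq => j; rewrite oconstE oidE [j]ord1.
Qed.

Definition degen_edge (X : sset) (x : X 0) : edge x x :=
  Edge (act (oconst 1 ord0) x) (degen_subproof x v0) (degen_subproof x v1).

Definition castA (C : category) (x y : C) (a : arrow C) (ex : adom a = x)
    (ey : acod a = y) : hom x y :=
  ecast y (hom x y) ey (ecast x (hom x (acod a)) ex (amor a)).

Lemma castAE (C : category) (x y : C) (a : arrow C) (ex : adom a = x)
    (ey : acod a = y) : Arrow (castA ex ey) = a.
Proof. by case: a ex ey => s t f /= ex ey; subst s t. Qed.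

Lemma Arrow_inj (C : category) (x y : C) (f g : hom x y) :
  Arrow f = Arrow g -> f = g.
Proof.
pose P (a : arrow C) := forall (ex : adom a = x) (ey : acod a = y),
  castA ex ey = g.
move=> E; have: P (Arrow f).
  rewrite E => /= ex ey.
  by rewrite (Prop_irrelevance ex erefl) (Prop_irrelevance ey erefl).
by move/(_ erefl erefl).
Qed.

Lemma Arrow_comp (C : category) (x y z x' y' z' : C) (f : hom x y)
    (g : hom y z) (f' : hom x' y') (g' : hom y' z') :
  Arrow f = Arrow f' -> Arrow g = Arrow g' -> Arrow (f ;; g) = Arrow (f' ;; g').
Proof.
move=> Ef Eg; move: (congr1 (@adom C) Ef) (congr1 (@acod C) Ef)
  (congr1 (@acod C) Eg) => /= ex ey ez; subst x' y' z'.
by rewrite (Arrow_inj Ef) (Arrow_inj Eg).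
Qed.

Lemma functor_eq (C D : category) (F G : functor C D) :
  (forall (x y : C) (f : hom x y), Arrow (fhom F f) = Arrow (fhom G f)) ->
  F = G.
Proof.
case: F G => [F0 F1 a b] [G0 G1 c d] /= E.
have E0 : F0 = G0 by apply: funext => x; have [] := E x x (idm x).
subst G0.
have E1 : F1 = G1.
  do 2![apply: functional_extensionality_dep => ?]; apply: funext => f.
  exact/Arrow_inj/E.
by subst G1; rewrite (Prop_irrelevance a c) (Prop_irrelevance b d).
Qed.

Definition ordcat (n : nat) : category :=
  @Category 'I_n.+1 (fun i j => is_true (i <= j)) (fun i => leqnn i)
    (fun i j k h h' => leq_trans h h')
    (fun _ _ _ => Prop_irrelevance _ _) (fun _ _ _ => Prop_irrelevance _ _)
    (fun _ _ _ _ _ _ _ => Prop_irrelevance _ _).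

Lemma ordcat_irr n (i j : ordcat n) (h h' : hom i j) : h = h'.
Proof. exact: (@Prop_irrelevance (i <= j)). Qed.

Definition ordcat_map m n (f : ordmap m n) : functor (ordcat m) (ordcat n) :=
  @Functor (ordcat m) (ordcat n) f (fun i j h => ordmap_homo f h)
    (fun _ => ordcat_irr _ _) (fun _ _ _ _ _ => ordcat_irr _ _).

Lemma ord_arrow n (C : category) (F : functor (ordcat n) C)
    (i j i' j' : ordcat n) (h : hom i j) (h' : hom i' j') :
  i = i' -> j = j' -> Arrow (fhom F h) = Arrow (fhom F h').
Proof. by move=> Ei Ej; subst i' j'; rewrite (ordcat_irr h h'). Qed.

Program Definition nerve (C : category) : sset :=
  @SSet (fun n => functor (ordcat n) C)
    (fun m n f F => fcomp F (ordcat_map f)) _ _.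
Next Obligation.
apply: functor_eq => i j h.
exact: (@ord_arrow _ _ x _ _ _ _ _ _ (oidE i) (oidE j)).
Qed.
Next Obligation.
apply: functor_eq => i j h.
exact: (@ord_arrow _ _ x _ _ _ _ _ _ (ocompE g f i) (ocompE g f j)).
Qed.

Program Definition nerve_map (C D : category) (F : functor C D) :
    smap (nerve C) (nerve D) :=
  @SMap (nerve C) (nerve D) (fun n G => fcomp F G) _.
Next Obligation. exact: functor_eq. Qed.

Lemma oedge_subproof n (i j : 'I_n.+1) : i <= j -> forall k l : 'I_2, k <= l ->
  (if k == v0 then i else j) <= (if l == v0 then i else j).
Proof. by move=> ij [[|[|//]] ?] [[|[|//]] ?] //= _; case: ifP. Qed.

Definition oedge n (i j : 'I_n.+1) (h : i <= j) : ordmap 1 n :=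
  mk_ordmap (oedge_subproof h).

Definition otri_fun n (i j k : 'I_n.+1) (a : 'I_3) : 'I_n.+1 :=
  match (a : nat) with 0 => i | 1 => j | _ => k end.

Lemma otri_subproof n (i j k : 'I_n.+1) : i <= j -> j <= k ->
  forall a b : 'I_3, a <= b -> otri_fun i j k a <= otri_fun i j k b.
Proof.
move=> ij jk [[|[|[|//]]] ?] [[|[|[|//]]] ?] //= _.
exact: leq_trans jk.
Qed.

Definition otri n (i j k : 'I_n.+1) (h : i <= j) (h' : j <= k) : ordmap 2 n :=
  mk_ordmap (otri_subproof h h').

Section Unit.
Variables (X : sset) (n : nat) (s : X n).

Lemma vedge_src (i j : 'I_n.+1) (h : i <= j) :
  act (oconst 0 v0) (act (oedge h) s) = act (oconst 0 i) s.
Proof. by rewrite -actM ocomp_constr mk_ordmapE. Qed.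
Lemma vedge_tgt (i j : 'I_n.+1) (h : i <= j) :
  act (oconst 0 v1) (act (oedge h) s) = act (oconst 0 j) s.
Proof. by rewrite -actM ocomp_constr mk_ordmapE. Qed.

Definition vedge (i j : 'I_n.+1) (h : i <= j) :
    edge (act (oconst 0 i) s) (act (oconst 0 j) s) :=
  Edge (act (oedge h) s) (vedge_src h) (vedge_tgt h).

Lemma vedge1 (i : 'I_n.+1) : degenerate (vedge (leqnn i)).
Proof.
rewrite /degenerate /= -actM ocomp_constl; congr act; apply: ordmap_eq => k.
by rewrite mk_ordmapE oconstE; case: ifP.
Qed.

Lemma vedgeM (i j k : 'I_n.+1) (h : i <= j) (h' : j <= k) :
  bounds (act (otri h h') s) (vedge h) (vedge h') (vedge (leq_trans h h')).
Proof.
by split; rewrite -actM /=; congr act; apply: ordmap_eq => -[[|[|//]] ?];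
  rewrite ocompE cofaceE !mk_ordmapE /otri_fun /= inordK.
Qed.

Definition hunit_simp : functor (ordcat n) (hcat X) :=
  @Functor (ordcat n) (hcat X) (fun i => act (oconst 0 i) s)
    (fun i j h => hedge (vedge h))
    (fun i => hedge_deg (vedge1 i))
    (fun i j k h h' => esym (hedge_tri (vedgeM h h'))).

End Unit.

Lemma Arrow_hedge (X : sset) (x y x' y' : X 0) (e : edge x y)
    (e' : edge x' y') :
  edge_simp e = edge_simp e' ->
  Arrow (hedge e) = Arrow (hedge e') :> arrow (hcat X).
Proof.
case: e e' => [e a b] [e' a' b'] /= E; subst e' x y x' y'.
by congr (Arrow (hedge _)); apply: edge_eq.
Qed.

Program Definition hunit (X : sset) : smap X (nerve (hcat X)) :=
  @SMap X (nerve (hcat X)) (fun n s => hunit_simp s) _.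
Next Obligation.
apply: functor_eq => i j h; apply: Arrow_hedge => /=.
rewrite -actM; congr act; apply: ordmap_eq => k.
by rewrite ocompE !mk_ordmapE; case: ifP.
Qed.

Section Adjoint.
Variables (X : sset) (C : category) (g : smap X (nerve C)).

Let le01 : @hom (ordcat 1) v0 v1 := leq0n 1.
Let G0 (x : X 0) : C := (g 0 x : functor _ _) ord0.
Let GA (e : X 1) : arrow C := Arrow (fhom (g 1 e) le01).

Lemma G_vertex n (s : X n) i : G0 (act (oconst 0 i) s) = (g n s : functor _ _) i.
Proof. by rewrite /G0 smapP /= oconstE. Qed.

Lemma GA_act n (s : X n) (f : ordmap 1 n) (i j : ordcat n) (h : hom i j) :
  f v0 = i -> f v1 = j -> GA (act f s) = Arrow (fhom (g n s) h).
Proof. by move=> Ei Ej; rewrite /GA smapP; exact: (@ord_arrow _ _ (g n s) _ _ _ _ (ordmap_homo f le01) _ Ei Ej). Qed.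

Lemma GA_src (x y : X 0) (e : edge x y) : adom (GA (edge_simp e)) = G0 x.
Proof. by case: e => e /= <- _; rewrite G_vertex. Qed.
Lemma GA_tgt (x y : X 0) (e : edge x y) : acod (GA (edge_simp e)) = G0 y.
Proof. by case: e => e /= _ <-; rewrite G_vertex. Qed.

Let G1 (x y : X 0) (e : edge x y) : hom (G0 x) (G0 y) :=
  castA (GA_src e) (GA_tgt e).

Lemma G1_deg x (e : edge x x) : degenerate e -> G1 e = idm (G0 x).
Proof.
move=> H; apply: Arrow_inj; rewrite castAE H.
rewrite (@GA_act 0 x (oconst 1 ord0) ord0 ord0 (idm _)) ?oconstE //.
by rewrite fhom1.
Qed.

Lemma G1_tri x y z (s : X 2)
    (e01 : edge x y) (e12 : edge y z) (e02 : edge x z) :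
  bounds s e01 e12 e02 -> G1 e01 ;; G1 e12 = G1 e02.
Proof.
case=> H2 H0 H1; apply: Arrow_inj.
pose a : ordcat 2 := @Ordinal 3 0 isT; pose b : ordcat 2 := @Ordinal 3 1 isT.
pose c : ordcat 2 := @Ordinal 3 2 isT.
have ab : @hom (ordcat 2) a b by [].
have bc : @hom (ordcat 2) b c by [].
have E (i : 'I_3) k l (h : @hom (ordcat 2) k l) :
    lift i v0 = k :> nat -> lift i v1 = l :> nat ->
    GA (act (coface i) s) = Arrow (fhom (g 2 s) h).
  by move=> Ek El; apply: GA_act; apply: val_inj; rewrite cofaceE /= ?Ek ?El.
rewrite castAE -H1 (E _ _ _ (ab ;; bc)) /= ?inordK //.
rewrite (fhomM (g 2 s) ab bc); apply: Arrow_comp.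
  by rewrite castAE -H2 (E _ _ _ ab) //= inordK.
by rewrite castAE -H0 (E _ _ _ bc) //= inordK.
Qed.

(* Functors hX -> C correspond to maps X -> N(C) by F |-> N(F) o hunit. *)
Theorem hcat_adjoint :
  exists! F : functor (hcat X) C, scomp (nerve_map F) (hunit X) = g.
Proof.
exists (hrec G1_deg G1_tri); split.
  apply: smap_eq => n s; apply: functor_eq => i j h.
  rewrite [LHS](_ : _ = Arrow (G1 (vedge s h))); last first.
    by congr Arrow; exact: (hrec_edge G1_deg G1_tri (vedge s h)).
  by rewrite castAE; apply: GA_act; rewrite mk_ordmapE.
move=> F HF; apply: functor_eq => x y f.
have FE x' y' (e : edge x' y') :
    Arrow (fhom F (hedge e)) = GA (edge_simp e).
  rewrite /GA -HF /=.
  have := @Arrow_hedge X _ _ _ _ e (vedge (edge_simp e) le01).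
  have -> : edge_simp (vedge (edge_simp e) le01) = edge_simp e.
    rewrite /= -[RHS]act1; congr act; apply: ordmap_eq => k.
    by rewrite mk_ordmapE oidE; apply: val_inj; case: k => [[|[|//]] ?].
  by move/(_ erefl)/(congr1 (fun a => Arrow (fhom F (amor a)))).
move: x y f; apply: hcat_ind => [x|x y z e f IH].
  rewrite !fhom1.
  have E : F x = G0 x by rewrite -(GA_src (degen_edge x)) -FE.
  by rewrite E.
rewrite !fhomM; apply: Arrow_comp; last exact: IH.
by rewrite FE hrec_edge castAE.
Qed.

End Adjoint.

Program Definition pair_edge (X Y : sset) (x x' : X 0) (y y' : Y 0)
    (e : edge x x') (d : edge y y') : @edge (sprod X Y) (x, y) (x', y') :=
  @Edge (sprod X Y) _ _ (edge_simp e, edge_simp d) _ _.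
Next Obligation. by rewrite /= !edge_src. Qed.
Next Obligation. by rewrite /= !edge_tgt. Qed.

Lemma degen_bounds (X : sset) (x : X 0) :
  bounds (act (oconst 2 ord0) x) (degen_edge x) (degen_edge x) (degen_edge x).
Proof. by split; rewrite -actM ocomp_constl. Qed.

Lemma pair_bounds (X Y : sset) (x x' x'' : X 0) (y y' y'' : Y 0)
    (s : X 2) (t : Y 2) (e01 : edge x x') (e12 : edge x' x'')
    (e02 : edge x x'') (d01 : edge y y') (d12 : edge y' y'')
    (d02 : edge y y'') :
  bounds s e01 e12 e02 -> bounds t d01 d12 d02 ->
  @bounds (sprod X Y) _ _ _ (s, t)
    (pair_edge e01 d01) (pair_edge e12 d12) (pair_edge e02 d02).
Proof. by case=> a2 a0 a1 [b2 b0 b1]; split; rewrite /= ?a0 ?a1 ?a2 ?b0 ?b1 ?b2. Qed.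

Section Slices.
Variables X Y : sset.

Definition hinl_edge (y : Y 0) (x x' : X 0) (e : edge x x') :
    @hom (hcat (sprod X Y)) (x, y) (x', y) :=
  hedge (pair_edge e (degen_edge y)).
Definition hinr_edge (x : X 0) (y y' : Y 0) (d : edge y y') :
    @hom (hcat (sprod X Y)) (x, y) (x, y') :=
  hedge (pair_edge (degen_edge x) d).

Lemma hinl_deg y (x : X 0) (e : edge x x) :
  degenerate e -> hinl_edge y e = idm ((x, y) : hcat (sprod X Y)).
Proof. by move=> H; apply: hedge_deg; rewrite /degenerate /= H. Qed.

Lemma hinr_deg x (y : Y 0) (d : edge y y) :
  degenerate d -> hinr_edge x d = idm ((x, y) : hcat (sprod X Y)).
Proof. by move=> H; apply: hedge_deg; rewrite /degenerate /= H. Qed.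

Lemma hinl_tri y (x x' x'' : X 0) (s : X 2)
    (e01 : edge x x') (e12 : edge x' x'') (e02 : edge x x'') :
  bounds s e01 e12 e02 ->
  hinl_edge y e01 ;; hinl_edge y e12 = hinl_edge y e02.
Proof. by move=> H; apply: hedge_tri (pair_bounds H (degen_bounds y)). Qed.

Lemma hinr_tri x (y y' y'' : Y 0) (t : Y 2)
    (d01 : edge y y') (d12 : edge y' y'') (d02 : edge y y'') :
  bounds t d01 d12 d02 ->
  hinr_edge x d01 ;; hinr_edge x d12 = hinr_edge x d02.
Proof. by move=> H; apply: hedge_tri (pair_bounds (degen_bounds x) H). Qed.

Definition hinl (y : Y 0) : functor (hcat X) (hcat (sprod X Y)) :=
  hrec (@hinl_deg y) (@hinl_tri y).
Definition hinr (x : X 0) : functor (hcat Y) (hcat (sprod X Y)) :=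
  hrec (@hinr_deg x) (@hinr_tri x).

End Slices.

Lemma codegen_subproof (k : nat) (i j : 'I_3) :
  i <= j ->
  (if k < i then v1 else v0 : 'I_2) <= (if k < j then v1 else v0 : 'I_2).
Proof.
move=> ij; case: ifP => // ki; suff -> : k < j by [].
exact: leq_trans ij.
Qed.

(* codegen 0 is 0, 1, 1 and codegen 1 is 0, 0, 1. *)
Definition codegen (k : nat) : ordmap 2 1 := mk_ordmap (@codegen_subproof k).

Lemma act_src (X : sset) (x y : X 0) (e : edge x y) :
  act (oconst 1 v0) (edge_simp e) = act (oconst 1 ord0) x.
Proof. by case: e => e /= <- _; rewrite -actM ocomp_constl. Qed.

Lemma act_tgt (X : sset) (x y : X 0) (e : edge x y) :
  act (oconst 1 v1) (edge_simp e) = act (oconst 1 ord0) y.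
Proof. by case: e => e /= _ <-; rewrite -actM ocomp_constl. Qed.

Lemma codegen_coface k (i : 'I_3) (f : ordmap 1 1) :
  (forall j : 'I_2, f j = (if k < lift i j then v1 else v0) :> nat) ->
  ocomp (codegen k) (coface i) = f.
Proof.
move=> H; apply: ordmap_eq => j; rewrite ocompE cofaceE mk_ordmapE.
by apply: val_inj; rewrite [RHS]H.
Qed.

Lemma codegen0_bounds (X : sset) (x y : X 0) (e : edge x y) :
  bounds (act (codegen 0) (edge_simp e)) e (degen_edge y) e.
Proof.
split; rewrite -actM /=.
- rewrite (@codegen_coface _ _ (oid 1)) ?act1 // => -[[|[|//]] ?];
    by rewrite oidE /= inordK.
- rewrite -(act_tgt e); congr act; apply: codegen_coface => -[[|[|//]] ?];
    by rewrite oconstE /= inordK.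
- rewrite (@codegen_coface _ _ (oid 1)) ?act1 // => -[[|[|//]] ?];
    by rewrite oidE /= inordK.
Qed.

Lemma codegen1_bounds (X : sset) (x y : X 0) (e : edge x y) :
  bounds (act (codegen 1) (edge_simp e)) (degen_edge x) e e.
Proof.
split; rewrite -actM /=.
- rewrite -(act_src e); congr act; apply: codegen_coface => -[[|[|//]] ?];
    by rewrite oconstE /= inordK.
- rewrite (@codegen_coface _ _ (oid 1)) ?act1 // => -[[|[|//]] ?];
    by rewrite oidE /= inordK.
- rewrite (@codegen_coface _ _ (oid 1)) ?act1 // => -[[|[|//]] ?];
    by rewrite oidE /= inordK.
Qed.

Lemma interchange_edge (X Y : sset) (x x' : X 0) (y y' : Y 0)
    (e : edge x x') (d : edge y y') :
  hinl_edge y e ;; hinr_edge x' d = hinr_edge x d ;; hinl_edge y' e.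
Proof.
rewrite (hedge_tri (pair_bounds (codegen0_bounds e) (codegen1_bounds d))).
by rewrite (hedge_tri (pair_bounds (codegen1_bounds e) (codegen0_bounds d))).
Qed.

Lemma interchange (X Y : sset) (x x' : hcat X) (y y' : hcat Y)
    (f : hom x x') (g : hom y y') :
  fhom (hinl X y) f ;; fhom (hinr Y x') g =
  fhom (hinr Y x) g ;; fhom (hinl X y') f.
Proof.
move: x x' f; apply: hcat_ind => [x|x x' x'' e f IH].
  by rewrite !(fhom1 (hinl X _)) compm1l compm1r.
rewrite !(fhomM (hinl X _)) -compmA IH !compmA; congr (_ ;; _).
rewrite !hrec_edge {IH f x''}.
move: y y' g; apply: hcat_ind => [y|y y' y'' d g IH].
  by rewrite !(fhom1 (hinr Y _)) compm1l compm1r.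
rewrite !(fhomM (hinr Y _)) !hrec_edge compmA interchange_edge.
by rewrite -!compmA IH.
Qed.

Section HProd.
Variables X Y : sset.

Definition hprod_hom (x y : prod_cat (hcat X) (hcat Y)) (f : hom x y) :
    @hom (hcat (sprod X Y)) (x.1, x.2) (y.1, y.2) :=
  fhom (hinl X x.2) f.1 ;; fhom (hinr Y y.1) f.2.

Lemma hprod1 (x : prod_cat (hcat X) (hcat Y)) :
  hprod_hom (idm x) = idm ((x.1, x.2) : hcat (sprod X Y)).
Proof.
by rewrite /hprod_hom (fhom1 (hinl X _)) (fhom1 (hinr Y _)) compm1l.
Qed.

Lemma hprodM (x y z : prod_cat (hcat X) (hcat Y)) (f : hom x y) (g : hom y z) :
  hprod_hom (f ;; g) = hprod_hom f ;; hprod_hom g.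
Proof.
rewrite /hprod_hom (fhomM (hinl X _)) (fhomM (hinr Y _)) -!compmA.
congr (_ ;; _); rewrite !compmA; congr (_ ;; _); exact: interchange.
Qed.

(* The inverse of the canonical functor h(X x Y) -> hX x hY. *)
Definition hprod : functor (prod_cat (hcat X) (hcat Y)) (hcat (sprod X Y)) :=
  Functor hprod1 hprodM.

End HProd.

Program Definition fid (C : category) : functor C C :=
  @Functor C C (fun x => x) (fun x y f => f) _ _.

Section HProj.
Variables X Y : sset.

Definition spr1 : smap (sprod X Y) X :=
  @SMap (sprod X Y) X (fun n u => u.1) (fun _ _ _ _ => erefl).
Definition spr2 : smap (sprod X Y) Y :=
  @SMap (sprod X Y) Y (fun n u => u.2) (fun _ _ _ _ => erefl).

Definition hproj_hom (u v : hcat (sprod X Y)) (f : hom u v) :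
    @hom (prod_cat (hcat X) (hcat Y)) (u.1, u.2) (v.1, v.2) :=
  (fhom (hmap spr1) f, fhom (hmap spr2) f).

Lemma hproj1 (u : hcat (sprod X Y)) :
  hproj_hom (idm u) = idm ((u.1, u.2) : prod_cat (hcat X) (hcat Y)).
Proof. by rewrite /hproj_hom !(fhom1 (hmap _)). Qed.

Lemma hprojM (u v w : hcat (sprod X Y)) (f : hom u v) (g : hom v w) :
  hproj_hom (f ;; g) = hproj_hom f ;; hproj_hom g.
Proof. by rewrite /hproj_hom !(fhomM (hmap _)). Qed.

(* The canonical functor h(X x Y) -> hX x hY. *)
Definition hproj : functor (hcat (sprod X Y)) (prod_cat (hcat X) (hcat Y)) :=
  Functor hproj1 hprojM.

Lemma hmap_edge (U V : sset) (u : smap U V) (x y : U 0) (e : edge x y) :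
  fhom (hmap u) (hedge e) = hedge (smap_edge u e).
Proof. exact: hrec_edge. Qed.

Lemma hproj_hinl (y : hcat Y) (x x' : hcat X) (f : hom x x') :
  fhom hproj (fhom (hinl X y) f) = (f, idm y).
Proof.
move: x x' f; apply: hcat_ind => [x|x x' x'' e f IH].
  by rewrite (fhom1 (hinl X y)) (fhom1 hproj).
rewrite (fhomM (hinl X y)) (fhomM hproj) IH (hrec_edge (@hinl_deg X Y y)).
rewrite [fhom hproj _](_ : _ = (hedge e, idm y)).
  by cbn [compm prod_cat fst snd]; rewrite compm1l.
by congr pair; rewrite hmap_edge; [congr hedge; exact: edge_eq
  | exact: hedge_deg].
Qed.

Lemma hproj_hinr (x : hcat X) (y y' : hcat Y) (g : hom y y') :
  fhom hproj (fhom (hinr Y x) g) = (idm x, g).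
Proof.
move: y y' g; apply: hcat_ind => [y|y y' y'' d g IH].
  by rewrite (fhom1 (hinr Y x)) (fhom1 hproj).
rewrite (fhomM (hinr Y x)) (fhomM hproj) IH (hrec_edge (@hinr_deg X Y x)).
rewrite [fhom hproj _](_ : _ = (idm x, hedge d)).
  by cbn [compm prod_cat fst snd]; rewrite compm1l.
by congr pair; rewrite hmap_edge; [exact: hedge_deg
  | congr hedge; exact: edge_eq].
Qed.

Lemma hprodK : fcomp hproj (hprod X Y) = fid _.
Proof.
apply: functor_eq => -[x y] [x' y'] [f g]; congr Arrow.
rewrite [LHS](fhomM hproj (fhom (hinl X y) f) (fhom (hinr Y x') g)).
rewrite hproj_hinl hproj_hinr; cbn [compm prod_cat fst snd].
by rewrite compm1l compm1r.
Qed.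

Lemma hprojK : fcomp (hprod X Y) hproj = fid _.
Proof.
apply: functor_eq => u v f; move: u v f.
apply: hcat_ind => [u|u v w e f IH].
  by rewrite fhom1; case: u.
rewrite !fhomM; apply: Arrow_comp; last exact: IH.
case: u v e {IH f} => [x y] [x' y'] e; congr Arrow.
pose e1 := smap_edge spr1 e; pose e2 := smap_edge spr2 e.
have E : hinl_edge y e1 ;; hinr_edge x' e2 = hedge e.
  rewrite (hedge_tri (pair_bounds (codegen0_bounds e1) (codegen1_bounds e2))).
  by congr hedge; apply: edge_eq => /=; case: (edge_simp e).
apply: etrans E.
rewrite -(hrec_edge (@hinl_deg X Y y) (@hinl_tri X Y y)).
rewrite -(hrec_edge (@hinr_deg X Y x') (@hinr_tri X Y x')).
by rewrite -!hmap_edge.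
Qed.

End HProj.

Definition hom' (X Y : sset) : category := hcat (ihom X Y).

Program Definition icomp_simp (X Y Z : sset) n (g : ihom Y Z n)
    (f : ihom X Y n) : ihom X Z n :=
  @SMap (sprod X (simplex n)) Z (fun m q => g m (f m q, q.2)) _.
Next Obligation. by rewrite -smapP /= -smapP. Qed.

Lemma icomp_subproof (X Y Z : sset) m n (t : ordmap m n)
    (p : sprod (ihom Y Z) (ihom X Y) n) :
  icomp_simp (act t p).1 (act t p).2 = act t (icomp_simp p.1 p.2).
Proof. exact: smap_eq. Qed.

(* Composition of internal homs, (g, f) |-> ((x, s) |-> g(f(x, s), s)). *)
Definition icomp (X Y Z : sset) :
    smap (sprod (ihom Y Z) (ihom X Y)) (ihom X Z) :=
  @SMap (sprod (ihom Y Z) (ihom X Y)) (ihom X Z)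
    (fun n p => icomp_simp p.1 p.2) (@icomp_subproof X Y Z).

Definition hcomp (X Y Z : sset) :
    functor (prod_cat (hom' Y Z) (hom' X Y)) (hom' X Z) :=
  fcomp (hmap (icomp X Y Z)) (hprod (ihom Y Z) (ihom X Y)).

Definition hpair (X P A : sset) (p q : hom' P A) (f g : hom' X P)
    (b : hom p q) (t : hom f g) :
    @hom (prod_cat (hom' P A) (hom' X P)) (p, f) (q, g) := (b, t).

Lemma hcompM (X P A : sset) (p q r : hom' P A) (f g h : hom' X P)
    (b : hom p q) (c : hom q r) (s : hom f g) (t : hom g h) :
  fhom (hcomp X P A) (hpair b s) ;; fhom (hcomp X P A) (hpair c t) =
  fhom (hcomp X P A) (hpair (b ;; c) (s ;; t)).
Proof. by rewrite -fhomM. Qed.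

(* Composition of a 2-cell a : p => q with 1-cells and 2-cells into P: it takes
   f to the arrow a f : p f => q f and t : f => g to the square with sides
   p t and q t. *)
Section Whisker.
Variables (X P A : sset) (p q : hom' P A) (a : hom p q).

Definition whisker_ob (f : hom' X P) : arrow_cat (hom' X A) :=
  Arrow (fhom (hcomp X P A) (hpair a (idm f))).

Lemma whisker_sq (f g : hom' X P) (t : hom f g) :
  fhom (hcomp X P A) (hpair a (idm f)) ;; fhom (hcomp X P A) (hpair (idm q) t) =
  fhom (hcomp X P A) (hpair (idm p) t) ;; fhom (hcomp X P A) (hpair a (idm g)).
Proof. by rewrite !hcompM !compm1l !compm1r. Qed.

Definition whisker_hom (f g : hom' X P) (t : hom f g) :
    hom (whisker_ob f) (whisker_ob g) :=
  @Square _ (whisker_ob f) (whisker_ob g)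
    (fhom (hcomp X P A) (hpair (idm p) t))
    (fhom (hcomp X P A) (hpair (idm q) t)) (whisker_sq t).

Lemma whisker1 (f : hom' X P) : whisker_hom (idm f) = idm (whisker_ob f).
Proof.
apply: square_eq.
- exact: (fhom1 (hcomp X P A) (p, f)).
- exact: (fhom1 (hcomp X P A) (q, f)).
Qed.

Lemma whiskerM (f g h : hom' X P) (s : hom f g) (t : hom g h) :
  whisker_hom (s ;; t) = whisker_hom s ;; whisker_hom t.
Proof.
by apply: square_eq; cbn [whisker_hom sqdom sqcod compm arrow_cat];
  rewrite hcompM compm1l.
Qed.

Definition whisker : functor (hom' X P) (arrow_cat (hom' X A)) :=
  Functor whisker1 whiskerM.

End Whisker.

(* A 2-cell a : p => q : P -> A of qCat_2 exhibits P as a weak cotensor of A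
   by the category 2; P has to be an object of qCat_2. *)
Definition weak_cotensor_two (A P : sset) (p q : hom' P A) (a : hom p q) :
    Prop :=
  quasicategory P /\
  forall X : sset, quasicategory X -> smothering (whisker X a).

(* A^(Delta^1), the exponential A^2. *)
Definition arrow_sset (A : sset) : sset := ihom (simplex 1) A.

(* The evaluation map A^(Delta^1) x Delta^1 -> A. *)
Program Definition eval_map (A : sset) :
    smap (sprod (arrow_sset A) (simplex 1)) A :=
  @SMap (sprod (arrow_sset A) (simplex 1)) A
    (fun n u => u.1 n (u.2, oid n)) _.
Next Obligation. by rewrite -smapP /= ocomp1l ocomp1r. Qed.

(* Evaluation A^(Delta^1) -> A at the vertex i of Delta^1: domain evaluation
   for i = 0 and codomain evaluation for i = 1. *)
Program Definition eval_at (A : sset) (i : 'I_2) : smap (arrow_sset A) A :=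
  @SMap (arrow_sset A) A (fun n u => u n (oconst n i, oid n)) _.
Next Obligation. by rewrite -smapP /= ocomp1l ocomp1r ocomp_constl. Qed.

(* A map X -> Y as an object of hom'(X, Y), that is, a map X x Delta^0 -> Y. *)
Program Definition cell1 (X Y : sset) (f : smap X Y) : hom' X Y :=
  @SMap (sprod X (simplex 0)) Y (fun n u => f n u.1) _.
Next Obligation. by rewrite smapP. Qed.

Lemma eval_edge_subproof (A : sset) (i : 'I_2) :
  act (oconst 0 i) (eval_map A : ihom (arrow_sset A) A 1) =
  cell1 (eval_at A i).
Proof. by apply: smap_eq => n [u s] /=; rewrite ocomp_constl. Qed.

Definition eval_edge (A : sset) :
    @edge (ihom (arrow_sset A) A) (cell1 (eval_at A v0)) (cell1 (eval_at A v1)) :=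
  @Edge (ihom (arrow_sset A) A) _ _ (eval_map A)
    (eval_edge_subproof A v0) (eval_edge_subproof A v1).

(* The 2-cell p_0 => p_1 : A^(Delta^1) -> A represented by evaluation. *)
Definition eval_2cell (A : sset) :
    @hom (hom' (arrow_sset A) A) (cell1 (eval_at A v0)) (cell1 (eval_at A v1)) :=
  hedge (eval_edge A).

(* Main.v *)
(* Exponentials.  Lambda^n_k -> Delta^n is a retract of its pushout-product with
   Lambda^2_1 -> Delta^2, so A^K is a quasi-category once partial maps
   M x Delta^2 -> A defined at least on M x Lambda^2_1 extend.  Pair a simplex
   whose last vertex in row 0 is (l, 0) with the simplex obtained by inserting
   the vertex (l, 1) right after it: the former is the inner face l+1 of the
   latter, and all other faces of the latter precede in the lexicographic order
   on (dimension, l).  A maximal partial map that is closed under this pairing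
   (Zorn) is therefore total.

   Weak cotensor.  By currying, the objects and edges of hom'(X, A^2) are edges
   and squares in the quasi-category B = A^X.  Edges of B represent all morphisms
   of hB and 2-simplices of B all commutative triangles, so commutative squares
   of hB lift: glue two 2-simplices along the diagonal.  For conservativity, cut
   a square whose two sides are invertible in hB along its diagonal into two
   squares, each with one degenerate side.  Such a square is given by a single
   2-simplex, and filling an inner 3-horn gives a one-sided inverse of the same
   shape; applying this twice shows that it is invertible. *)

From mathcomp Require Import all_boot zify.
From mathcomp Require Import boolp classical_sets.
Require Import Defs.

Set Implicit Arguments.
Unset Strict Implicit.
Unset Printing Implicit Defensive.

(** * Monotone maps and horns *)

Lemma nat_ordmap_subproof m n (f : nat -> nat)
    (H : forall i j, i <= j <= m -> f i <= f j <= n) (i j : 'I_m.+1) :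
  i <= j -> (inord (f i) : 'I_n.+1) <= (inord (f j) : 'I_n.+1).
Proof.
move=> ij; have Hj := ltn_ord j.
have /andP[Hij Hn] : f i <= f j <= n by apply: H; lia.
by rewrite !inordK //; lia.
Qed.

Definition nat_ordmap m n f (H : forall i j, i <= j <= m -> f i <= f j <= n) :
  ordmap m n := mk_ordmap (nat_ordmap_subproof H).

Lemma nat_ordmapE m n f (H : forall i j, i <= j <= m -> f i <= f j <= n) i :
  nat_ordmap H i = f i :> nat.
Proof.
rewrite mk_ordmapE inordK //.
by have /andP[] : f i <= f i <= n by apply: H; have := ltn_ord i; lia.
Qed.

Lemma ordmap_eqn m n (f g : ordmap m n) :
  (forall i, f i = g i :> nat) -> f = g.
Proof. by move=> E; apply: ordmap_eq => i; apply: val_inj; exact: E. Qed.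

Lemma cofaceEn n (i : 'I_n.+2) j : coface i j = (i <= j) + j :> nat.
Proof. by rewrite cofaceE. Qed.

Lemma ordmap0E m (f : ordmap m 0) i : f = oconst m i.
Proof. by apply: ordmap_eq => j; rewrite [f j]ord1 [RHS]ord1. Qed.

(* The clipping by [n] matters only on the last vertex, when [n < i]. *)
Lemma collapse_subproof n i a b : a <= b <= n.+1 ->
  minn (a - (i < a)) n <= minn (b - (i < b)) n <= n.
Proof. lia. Qed.
Definition collapse n i : ordmap n.+1 n := nat_ordmap (@collapse_subproof n i).

Lemma coface_collapse m n (i : 'I_n.+2) (t : ordmap m n.+1) :
  (forall j, t j != i) -> ocomp (coface i) (ocomp (collapse n i) t) = t.
Proof.
move=> ti; apply: ordmap_eqn => j; rewrite !ocompE cofaceEn nat_ordmapE.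
have := ti j; rewrite -val_eqE /=.
by have := ltn_ord (t j); have := ltn_ord i; lia.
Qed.

Lemma in_hornP n (k : 'I_n.+1) m (s : ordmap m n) :
  reflect (exists2 i, i != k & forall j, s j != i) (in_horn k s).
Proof.
apply: (iffP existsP) => [[i /andP[ik /forallP si]]|[i ik si]]; exists i => //.
by rewrite ik; apply/forallP.
Qed.

Lemma coface_in_horn n (k i : 'I_n.+2) : i != k -> in_horn k (coface i).
Proof.
by move=> ik; apply/in_hornP; exists i => // j; rewrite cofaceE eq_sym neq_lift.
Qed.

Lemma notin_horn n (k : 'I_n.+1) m (s : ordmap m n) i :
  ~~ in_horn k s -> i != k -> exists j, s j = i.
Proof.
move=> sh ik; have [/existsP[j /eqP E]|H] := boolP [exists j, s j == i].
  by exists j.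
case/negP: sh; apply/in_hornP; exists i => // j.
by apply: contra H => E; apply/existsP; exists j.
Qed.

(** * Inner horns given by compatible faces *)

Section HornFiller.
Variables (X : sset) (hX : quasicategory X) (n : nat) (k : 'I_n.+3).
Hypothesis hk : 0 < k < n.+2.
Variable x : 'I_n.+3 -> X n.+1.
Hypothesis xE : forall i j : 'I_n.+3, i < j -> i != k -> j != k ->
  act (coface (inord i)) (x j) = act (coface (inord j.-1)) (x i).

(** [collapse n.+1 i] is a retraction of [coface i], so this is the value on [t] forced by the
    [i]-th face whenever [t] misses [i]. *)
Let face m (t : ordmap m n.+2) (i : 'I_n.+3) :=
  act (ocomp (collapse n.+1 i) t) (x i).

(** A simplex missing both [i] and [j] factors through their common codimension-two face, where [xE]
    makes the two values agree. *)
Lemma horn_face_unique m (t : ordmap m n.+2) (i j : 'I_n.+3) :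
  i != k -> j != k -> (forall l, t l != i) -> (forall l, t l != j) ->
  face t i = face t j.
Proof.
wlog ij : i j / i < j.
  move=> H ik jk ti tj; case: (ltngtP i j) => [ij|ji|/val_inj-> //].
    exact: H.
  by symmetry; exact: H.
move=> ik jk ti tj; have Hj := ltn_ord j.
have := xE ij ik jk; set a := inord i; set b := inord j.-1 => E.
have Ea : a = i :> nat by rewrite inordK //; lia.
have Eb : b = j.-1 :> nat by rewrite inordK //; lia.
pose u := ocomp (collapse n a) (ocomp (collapse n.+1 j) t).
have -> : face t i = act u (act (coface b) (x i)).
  rewrite -actM; congr act; apply: ordmap_eqn => l.
  rewrite !ocompE cofaceEn !nat_ordmapE Ea Eb.
  have := ti l; have := tj l; rewrite -!val_eqE /=; have := ltn_ord (t l); lia.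
rewrite -E -actM; congr act; apply: ordmap_eqn => l.
rewrite !ocompE cofaceEn !nat_ordmapE Ea.
have := ti l; have := tj l; rewrite -!val_eqE /=; have := ltn_ord (t l); lia.
Qed.

(** The choice need not be natural: a restriction of [s] still misses [missed s], and
    [horn_face_unique] compares the two values. *)
Let missed m (s : horn k m) : 'I_n.+3 := xchoose (existsP (valP s)).

Lemma missedP m (s : horn k m) : missed s != k /\ forall j, val s j != missed s.
Proof. by have /andP[? /forallP] := xchooseP (existsP (valP s)). Qed.

Lemma horn_fun_subproof l m (f : ordmap l m) (s : horn k m) :
  face (val (act f s)) (missed (act f s)) = act f (face (val s) (missed s)).
Proof.
have [k1 m1] := missedP s; have [k2 m2] := missedP (act f s).
rewrite (@horn_face_unique _ _ _ (missed s)) //; first by rewrite /face -actM ocompA.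
by move=> j; rewrite ocompE.
Qed.

Definition horn_fun : smap (horn k) X := SMap horn_fun_subproof.

Lemma horn_filler :
  exists y : X n.+2, forall i, i != k -> act (coface i) y = x i.
Proof.
have [g Hg] := hX hk horn_fun; exists (g _ (oid n.+2)) => i ik.
rewrite -smapP /= ocomp1l.
rewrite -[coface i]/(val (exist _ (coface i) (coface_in_horn ik) : horn k _)) Hg.
set s := exist _ _ _; have [k1 m1] := missedP s.
rewrite [LHS](@horn_face_unique _ _ _ i) // ?/face /=.
  rewrite -[RHS]act1; congr act; apply: ordmap_eqn => j.
  rewrite ocompE nat_ordmapE cofaceEn oidE.
  by have := ltn_ord j; have := ltn_ord i; lia.
by move=> l; rewrite cofaceE eq_sym neq_lift.
Qed.

End HornFiller.

(* Monotonicity of the lift is automatic because [F] is injective. *)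
Lemma ordmap_lift m n p (t : ordmap p n) (F : ordmap m n) :
  injective F -> (forall i, exists j, t j = F i) ->
  forall i0 j0, t j0 = F i0 -> exists2 d : ordmap m p, ocomp t d = F & d i0 = j0.
Proof.
move=> Finj H i0 j0 E0.
have H' i : exists j, t j == F i by have [j E] := H i; exists j; rewrite E.
pose d i := if i == i0 then j0 else xchoose (H' i).
have tdE i : t (d i) = F i.
  by rewrite /d; case: eqP => [->//|_]; apply/eqP; exact: (xchooseP (H' i)).
have dmono (i j : 'I_m.+1) : i <= j -> d i <= d j.
  move=> ij; rewrite leqNgt; apply/negP => dji.
  have := ordmap_homo t (ltnW dji); rewrite !tdE => Fji.
  have E : F i = F j by apply/val_inj/eqP; rewrite eqn_leq Fji ordmap_homo.
  by move: dji; rewrite (Finj _ _ E) ltnn.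
exists (mk_ordmap dmono); last by rewrite mk_ordmapE /d eqxx.
by apply: ordmap_eq => i; rewrite ocompE mk_ordmapE tdE.
Qed.

Lemma coface_inj n (k : 'I_n.+2) : injective (coface k).
Proof. by move=> i j; rewrite !cofaceE => /lift_inj. Qed.

(** If every vertex is hit, then [e] is bijective by counting, and [e] and its section [d] are
    strictly increasing. Hence [i <= e i] and [e i <= d (e i) = i]. *)
Lemma ordmap_self m (e : ordmap m m) :
  e = oid m \/ exists i, forall j, e j != i.
Proof.
have [/existsP[i /forallP H]|] := boolP [exists i, forall j, e j != i].
  by right; exists i.
rewrite negb_exists => /forallP H; left.
have einj : injective e.
  have /image_injP einj : #|[seq e x | x in 'I_m.+1]| == #|'I_m.+1|.
    apply/eqP/eq_card => i.
    have := H i; rewrite negb_forall => /existsP[j]; rewrite negbK => /eqP <-.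
    by rewrite fintype.image_f.
  by move=> i j; exact: einj.
have [d ed _] : exists2 d : ordmap m m, ocomp e d = oid m & d (e ord0) = ord0.
  apply: ordmap_lift; last by rewrite oidE.
    by move=> i j; rewrite !oidE.
  move=> i; have := H i; rewrite negb_forall => /existsP[j].
  by rewrite negbK => /eqP <-; exists j; rewrite oidE.
have emono (i j : 'I_m.+1) : i < j -> e i < e j.
  move=> ij; rewrite ltn_neqAle ordmap_homo ?(ltnW ij) // andbT.
  by apply/negP => /eqP/val_inj/einj E; rewrite E ltnn in ij.
have le_e (f : ordmap m m) : (forall i j : 'I_m.+1, i < j -> f i < f j) ->
    forall i : 'I_m.+1, i <= f i.
  move=> fmono [i Hi]; elim: i Hi => // i IH Hi.
  exact: leq_ltn_trans (IH (ltnW Hi)) (fmono (Ordinal (ltnW Hi)) (Ordinal Hi) _).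
have dmono (i j : 'I_m.+1) : i < j -> d i < d j.
  move=> ij; rewrite ltnNge; apply/negP => /(ordmap_homo e).
  by rewrite -!ocompE ed !oidE leqNgt ij.
apply: ordmap_eqn => i; apply/eqP; rewrite oidE eqn_leq le_e // andbT.
have E : d (e i) = i by apply: einj; rewrite -(ocompE e d) ed oidE.
by apply: leq_trans (le_e _ dmono (e i)) _; rewrite E.
Qed.

(** * Partial maps and inner horns *)

Section PartialMaps.
Variables Y A : sset.
Local Open Scope classical_set_scope.

(** Partial maps are encoded by graphs so that the upper bound of a chain, needed for Zorn's lemma,
    is a plain union of sets. *)
Definition graph : Type := set {n : nat & (Y n * A n)%type}.
Definition graph_rel (G : graph) n (y : Y n) (a : A n) : Prop :=
  G (existT (fun n => (Y n * A n)%type) n (y, a)).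
Definition graph_dom (G : graph) n (y : Y n) : Prop :=
  exists a, graph_rel G y a.
Definition partial_map (G : graph) : Prop :=
  (forall n (y : Y n) a b, graph_rel G y a -> graph_rel G y b -> a = b) /\
  (forall m n (f : ordmap m n) (y : Y n) a,
    graph_rel G y a -> graph_rel G (act f y) (act f a)).

Lemma graph_dom_act G : partial_map G -> forall m n (f : ordmap m n) (y : Y n),
  graph_dom G y -> graph_dom G (act f y).
Proof. by case=> _ H m n f y [a ya]; exists (act f a); exact: H. Qed.

Section Attach.
Hypothesis hA : quasicategory A.
Variables (G : graph) (hG : partial_map G) (n : nat) (k : 'I_n.+2).
Hypothesis hk : 0 < k < n.+1.
Variable tau : Y n.+1.
Hypothesis tau_horn : forall m (t : ordmap m n.+1),
  in_horn k t -> graph_dom G (act t tau).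
Hypothesis tau_face : ~ graph_dom G (act (coface k) tau).

Lemma attach_filler : exists z : A n.+1, forall m (t : ordmap m n.+1),
  in_horn k t -> graph_rel G (act t tau) (act t z).
Proof.
pose h m (s : horn k m) : A m := projT1 (cid (tau_horn (valP s))).
have hP m (s : horn k m) : graph_rel G (act (val s) tau) (h m s).
  exact: projT2 (cid (tau_horn (valP s))).
have hM l m (f : ordmap l m) (s : horn k m) : h l (act f s) = act f (h m s).
  apply: hG.1 (hP _ _) _; rewrite /= actM; exact/hG.2/hP. 
have [g Hg] := hA hk (SMap hM); exists (g _ (oid n.+1)) => m t th.
by rewrite -smapP /= ocomp1l (Hg _ (exist _ t th)); exact: (hP m (exist _ t th)).
Qed.

(** Outside the horn every vertex except [k] is hit, so the face [coface k] can be recovered from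
    [t], by a section through any prescribed [j] with [t j] different from [k]. *)
Lemma attach_section m (t : ordmap m n.+1) : ~~ in_horn k t ->
  forall i j, t j = coface k i ->
  exists2 d : ordmap n m, ocomp t d = coface k & d i = j.
Proof.
move=> th; apply: (ordmap_lift (@coface_inj _ _)) => i.
by apply: (notin_horn th); rewrite cofaceE eq_sym neq_lift.
Qed.

Lemma attach_new m (t : ordmap m n.+1) :
  ~~ in_horn k t -> ~ graph_dom G (act t tau).
Proof.
move=> th H; have [j E] : exists j, t j = coface k ord0.
  by apply: (notin_horn th); rewrite cofaceE eq_sym neq_lift.
have [d td _] := attach_section th E.
by apply: tau_face; rewrite -td actM; exact: graph_dom_act.
Qed.

Lemma attach_inj m (t t' : ordmap m n.+1) :
  ~~ in_horn k t -> ~~ in_horn k t' -> act t tau = act t' tau -> t = t'.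
Proof.
(* By symmetry it suffices to compare the maps at a [j] that one of them does not send to [k]. *)
have half (s s' : ordmap m n.+1) j : ~~ in_horn k s ->
    act s tau = act s' tau -> s j != k -> s' j = s j.
  move=> sh E; rewrite eq_sym => /unlift_some[i si _].
  have [|d sd di] := attach_section sh (i := i) (j := j); first by rewrite cofaceE.
  have E1 : act (coface k) tau = act (ocomp s' d) tau.
    by rewrite -sd !actM E.
  (* If [k] is hit, then missing another vertex would put the composite in the horn and the new face
     in the domain of [G]; hitting all [n.+2] vertices from [n.+1] is impossible. *)
  have sk l : ocomp s' d l != k.
    apply/eqP => lk; apply: tau_face; rewrite E1; apply: tau_horn.
    have [/existsP[i0 /forallP H]|] :=
        boolP [exists i0, forall j, ocomp s' d j != i0].
      apply/in_hornP; exists i0 => //; apply/eqP => E0.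
      by have := H l; rewrite lk E0 eqxx.
    rewrite negb_exists => /forallP H.
    have : #|'I_n.+2| <= #|'I_n.+1|.
      apply: leq_trans (leq_image_card (ocomp s' d) 'I_n.+1).
      apply/subset_leq_card/fintype.subsetP => i0 _.
      have := H i0; rewrite negb_forall => /existsP[j0]; rewrite negbK => /eqP <-.
      by rewrite fintype.image_f.
    by rewrite !card_ord ltnn.
  have {}sk := coface_collapse sk; set e := ocomp (collapse n k) _ in sk.
  have E2 : act (coface k) tau = act e (act (coface k) tau).
    by rewrite -actM sk -E1.
  (* The new face is now its own restriction along [e]. If [e] is the identity, [s'] and [s] agree
     along [d]; if [e] misses a vertex, the face comes from the horn and is not new. *)
  have [e1|[i0 ei0]] := ordmap_self e.
    by rewrite -di -(ocompE s' d) -sk e1 ocomp1r -(ocompE s d) sd.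
  case: tau_face; rewrite E2 -actM; apply: tau_horn; apply/in_hornP.
  exists (coface k i0); first by rewrite cofaceE eq_sym neq_lift.
  by move=> l; rewrite ocompE (inj_eq (@coface_inj _ _)).
move=> th th' E; apply: ordmap_eq => j.
have [tk|tk] := eqVneq (t j) k; last by rewrite (half t t').
have [t'k|t'k] := eqVneq (t' j) k; first by rewrite tk t'k.
by rewrite (half t' t).
Qed.

(* A pushout along the inner horn: outside the horn, distinct simplices of
   Delta^(n+1) have distinct images under [tau] because the missing face is new. *)
Lemma attach : exists G' : graph, [/\ partial_map G', G `<=` G' &
  forall m (y : Y m),
    graph_dom G' y <-> graph_dom G y \/ exists t, y = act t tau].
Proof.
have [z zP] := attach_filler.
pose G' : graph :=
  [set p | G p \/ exists t, projT2 p = (act t tau, act t z)].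
have new_old m (t : ordmap m n.+1) b : graph_rel G (act t tau) b -> b = act t z.
  move=> Hb; have [th|th] := boolP (in_horn k t).
    exact: hG.1 Hb (zP _ _ th).
  by case: (attach_new th); exists b.
exists G'; split; first split.
- move=> m y a b [Ga|[t [-> ->]]] [Gb|[t' [Et ->]]].
  + exact: hG.1 Ga Gb.
  + by apply: new_old; rewrite -Et.
  + by symmetry; apply: new_old.
  + have [th|th] := boolP (in_horn k t).
      by apply: new_old; rewrite -Et; exact: zP.
    have [th'|th'] := boolP (in_horn k t').
      by symmetry; apply: new_old; rewrite Et; exact: zP.
    by rewrite (attach_inj th th' Et).
- move=> l m f y a [Ga|[t [-> ->]]]; first by left; exact: hG.2.
  by right; exists (ocomp t f); rewrite !actM.
- by move=> p Gp; left.
- move=> m y; split.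
    by case=> a [Ga|[t [-> _]]]; [left; exists a|right; exists t].
  case=> [[a Ga]|[t ->]]; first by exists a; left.
  by exists (act t z); right; exists t.
Qed.

End Attach.
End PartialMaps.

(** * Extension from M x Lambda^2_1 to M x Delta^2 *)

Definition last_zero n (s : ordmap n 2) (l : 'I_n.+1) : Prop :=
  forall i, (s i == 0 :> nat) = (i <= l).

Lemma last_zeroP n (s : ordmap n 2) : ~~ in_horn (inord 1 : 'I_3) s ->
  exists2 l : 'I_n.+1, last_zero s l & l < n.
Proof.
move=> sh.
have [j0 E0] : exists j, s j = ord0.
  by apply: (notin_horn sh); rewrite -val_eqE /= inordK.
have [j2 E2] : exists j, s j = ord_max.
  by apply: (notin_horn sh); rewrite -val_eqE /= inordK.
case: (@arg_maxnP _ j0 (fun i => s i == ord0) (fun i => i)); first by rewrite E0.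
move=> l /eqP sl lmax; have ls : last_zero s l.
  move=> i; apply/idP/idP => [si|il]; first by apply: lmax; rewrite -val_eqE.
  by have := ordmap_homo s il; rewrite sl leqn0.
exists l => //; have := ls j2; rewrite E2 /=; have := ltn_ord j2; lia.
Qed.

Section InsertOne.
Variables (n : nat) (s : ordmap n 2) (l : 'I_n.+1).
Hypothesis ls : last_zero s l.

Lemma insert_one_subproof (i j : 'I_n.+2) : i <= j ->
  (if i == l.+1 :> nat then inord 1 else s (collapse n l i) : 'I_3) <=
  (if j == l.+1 :> nat then inord 1 else s (collapse n l j) : 'I_3).
Proof.
move=> ij; have Hj := ltn_ord j; have Hl := ltn_ord l.
case: (eqVneq (i : nat) _) => Ei; case: (eqVneq (j : nat) _) => Ej //.
- have := ls (collapse n l j); rewrite nat_ordmapE !inordK //; lia.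
- have := ls (collapse n l i); rewrite nat_ordmapE !inordK //; lia.
- exact/ordmap_homo/ordmap_homo.
Qed.

Definition insert_one : ordmap n.+1 2 := mk_ordmap insert_one_subproof.

Lemma insert_one_eq (i : 'I_n.+2) : i = l.+1 :> nat -> insert_one i = 1 :> nat.
Proof. by move=> E; rewrite mk_ordmapE E eqxx inordK. Qed.
Lemma insert_one_neq (i : 'I_n.+2) :
  i <> l.+1 :> nat -> insert_one i = s (collapse n l i).
Proof. by move=> /eqP E; rewrite mk_ordmapE (negbTE E). Qed.

Lemma insert_one0 i : (insert_one i == 0 :> nat) = (i <= l).
Proof.
have Hi := ltn_ord i; have Hl := ltn_ord l.
have [E|E] := eqVneq (i : nat) l.+1; first by rewrite insert_one_eq // E ltnn.
rewrite insert_one_neq; last exact/eqP.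
by rewrite ls nat_ordmapE; lia.
Qed.

End InsertOne.

Section Filling.
Variables M A : sset.
Hypothesis hA : quasicategory A.
Local Open Scope classical_set_scope.
Notation Y := (sprod M (simplex 2)).

(* The pairs [(act th x, w)] below are the faces and degeneracies of the simplex
   [prism_cell], which inserts the vertex [(l, 1)] after [(l, 0)]. *)
Definition saturated (G : graph Y A) : Prop :=
  forall n (x : M n) (s : ordmap n 2) l, last_zero s l ->
  @graph_dom Y A G n (x, s) ->
  forall p (th : ordmap p n) (w : ordmap p 2),
    (forall j, w j = s (th j) \/ th j = l /\ w j = 1 :> nat) ->
  @graph_dom Y A G p (act th x, w).

Definition prism_cell n (x : M n) (s : ordmap n 2) l (ls : last_zero s l) :
  Y n.+1 := (act (collapse n l) x, insert_one ls).

Lemma prism_cell_face n (x : M n) (s : ordmap n 2) l (ls : last_zero s l) :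
  act (coface (inord l.+1)) (prism_cell x ls) = (x, s).
Proof.
have Hl := ltn_ord l.
rewrite /= -actM; congr pair.
  rewrite -[RHS]act1; congr act; apply: ordmap_eqn => i.
  have Hi := ltn_ord i.
  by rewrite ocompE nat_ordmapE cofaceEn inordK // oidE; lia.
apply: ordmap_eq => i; have Hi := ltn_ord i.
rewrite ocompE insert_one_neq ?cofaceEn ?inordK //; last lia.
congr (s _); apply: val_inj; rewrite /= nat_ordmapE cofaceEn inordK //; lia.
Qed.

(** Deleting such a vertex commutes with the insertion: the result inserts a row-1 vertex into a
    face of [(x, s)] of smaller dimension, so saturation applies. *)
Lemma prism_cell_side (G : graph Y A) n (x : M n) (s : ordmap n 2) l
    (ls : last_zero s l) (i : 'I_n.+2) m (t : ordmap m n.+1) :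
  saturated G -> l < n ->
  (forall m (x' : M m) s', m < n -> @graph_dom Y A G m (x', s')) ->
  i <> l :> nat -> i <> l.+1 :> nat -> (forall j, t j != i) ->
  graph_dom G (act t (prism_cell x ls)).
Proof.
case: n x s l ls i t => [|n] // x s l ls i t satG ln dimG il ik ti.
have Hl := ltn_ord l; have Hi := ltn_ord i.
(* [i'] is the position of the deleted vertex in [s], before the insertion, and [l'] is the last
   vertex in row 0 once [i'] is deleted. *)
have [i' i'E] : exists i' : 'I_n.+2, i' = i - (l < i) :> nat.
  by exists (inord (i - (l < i))); rewrite inordK //; lia.
have [l' l'E] : exists l' : 'I_n.+1, l' = l - (i' < l) :> nat.
  by exists (inord (l - (i' < l))); rewrite inordK //; lia.
pose th := ocomp (collapse n.+1 l) t; pose th' := ocomp (collapse n i') th.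
have thE : ocomp (coface i') th' = th.
  apply: coface_collapse => j; rewrite -val_eqE /= ocompE nat_ordmapE i'E.
  have := ti j; rewrite -val_eqE /=; have := ltn_ord (t j); lia.
rewrite /= -actM -/th -thE actM.
have l's : last_zero (ocomp s (coface i')) l'.
  move=> j; rewrite ocompE ls cofaceEn l'E; have := ltn_ord j; lia.
apply: (satG _ _ _ _ l's (dimG _ _ _ (ltnSn n))) => j; rewrite ocompE.
have [E|/eqP E] := eqVneq (t j : nat) l.+1.
  right; split; last exact: insert_one_eq.
  apply: val_inj; rewrite /= l'E ocompE /= nat_ordmapE ocompE nat_ordmapE E; lia.
left; rewrite insert_one_neq // ocompE; congr (s _).
by rewrite -(ocompE _ th') thE ocompE.
Qed.

Section Extend.
Variable G : graph Y A.
Hypotheses (hG : partial_map G) (satG : saturated G).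
Hypothesis hornG : forall n (x : M n) (s : ordmap n 2),
  in_horn (inord 1 : 'I_3) s -> @graph_dom Y A G n (x, s).
Variables (n : nat) (x : M n) (s : ordmap n 2) (l : 'I_n.+1).
Hypotheses (ls : last_zero s l) (ln : l < n).
Hypothesis dimG : forall m (x' : M m) s', m < n -> @graph_dom Y A G m (x', s').
Hypothesis rankG : forall (x' : M n) s' l', last_zero s' l' -> l' < l ->
  @graph_dom Y A G n (x', s').
Let tau := prism_cell x ls.

(** Face [l] has its last row-0 vertex at [l.-1], so [rankG] applies, or for [l = 0] it has none and
    lies over the horn. [prism_cell_side] covers the faces other than [l] and [l.+1]. *)
Lemma prism_cell_horn m (t : ordmap m n.+1) :
  in_horn (inord l.+1 : 'I_n.+2) t -> graph_dom G (act t tau).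
Proof.
have Hl := ltn_ord l.
case/in_hornP => i ik ti.
have {}ik : i <> l.+1 :> nat.
  by move=> E; case/eqP: ik; apply: val_inj; rewrite /= inordK.
have [il|il] := eqVneq (i : nat) l.
  rewrite -(coface_collapse ti) actM; apply: graph_dom_act => //.
  rewrite /tau /prism_cell /=; set s' := ocomp _ _.
  have s'0 j : (s' j == 0 :> nat) = (j < l).
    by rewrite ocompE insert_one0 cofaceEn il; lia.
  have [l0|l0] := eqVneq (l : nat) 0.
    apply: hornG; apply/in_hornP; exists ord0; first by rewrite -val_eqE /= inordK.
    by move=> j; rewrite -val_eqE /= s'0 l0.
  have ll : l.-1 < n.+1 by lia.
  apply: (rankG _ (l' := Ordinal ll)); last by rewrite /=; lia.
  by move=> j; rewrite s'0 /=; lia.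
apply: (prism_cell_side x ls satG ln dimG _ _ ti) => //; exact/eqP.
Qed.

Lemma extend_filling : ~ @graph_dom Y A G n (x, s) -> exists G' : graph Y A,
  [/\ partial_map G', saturated G', G `<=` G' & @graph_dom Y A G' n (x, s)].
Proof.
move=> nxs; have Hl := ltn_ord l; have Hn : l.+1 < n.+2 by lia.
have [|||G' [G'p GG' G'dom]] := @attach Y A hA G hG n (inord l.+1) _ tau.
- by rewrite inordK //; lia.
- exact: prism_cell_horn.
- by rewrite prism_cell_face.
exists G'; split=> //; last first.
  apply/G'dom; right; exists (coface (inord l.+1)).
  by rewrite prism_cell_face.
move=> m y u l1 l1u /G'dom[yu p th w Hw|[t Et] p th w Hw].
  apply/G'dom; left; exact: satG l1u yu _ _ _ Hw.
apply/G'dom; have Hl1 := ltn_ord l1.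
case: Et => Ey Eu.
(* Saturation of the new graph: if [t l1] is not [l], then [t] misses [l] and [(y, u)] is already in
   the domain of [G]. *)
have [tl|tl] := eqVneq (t l1 : nat) l; last first.
  left; apply: (satG l1u _ Hw).
  rewrite Ey Eu; apply: (@prism_cell_horn _ t).
  apply/in_hornP; exists (inord l); first by rewrite -val_eqE /= !inordK //; lia.
  move=> j; rewrite -val_eqE /= inordK; last lia.
  have tj i : (t i <= l) = (i <= l1) by rewrite -(insert_one0 ls) -(ocompE _ t) -Eu l1u.
  apply/eqP => tjl; have := tj j; rewrite tjl leqnn => /esym/(ordmap_homo t).
  have := tj l1; rewrite leqnn tjl; move: tl; lia.
right.
have wP j : w j != u (th j) -> th j = l1 /\ w j = 1 :> nat.
  by case: (Hw j) => // ->; rewrite eqxx.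
have u0 i : (t i <= l) = (i <= l1) by rewrite -(insert_one0 ls) -(ocompE _ t) -Eu l1u.
(* Otherwise [(act th y, w)] is again a restriction of [tau]: positions where [w] differs from [u]
   go to the inserted vertex [l.+1], which [collapse] identifies with [l = t l1]. *)
have mono (i j : 'I_p.+1) : i <= j ->
  (if w i == u (th i) then t (th i) else inord l.+1 : 'I_n.+2) <=
  (if w j == u (th j) then t (th j) else inord l.+1 : 'I_n.+2).
  move=> ij; case: ifPn => [_|/wP[Ei wi]]; case: ifPn => [/eqP wj|/wP[Ej wj]] //.
  - exact/ordmap_homo/ordmap_homo.
  - rewrite inordK // -tl -Ej ltnW // ltnS; exact/ordmap_homo/ordmap_homo.
  - rewrite inordK // ltnNge u0 -l1u -wj -lt0n.
    by rewrite (leq_trans _ (ordmap_homo w ij)) // wi.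
have Em j : collapse n l (mk_ordmap mono j) = collapse n l (t (th j)).
  rewrite mk_ordmapE; case: ifPn => // /wP[-> _]; apply: val_inj.
  by rewrite /= !nat_ordmapE inordK // tl; lia.
exists (mk_ordmap mono); rewrite /= Ey -!actM; congr pair.
  by congr act; apply: ordmap_eq => j; rewrite !ocompE Em.
apply: ordmap_eq => j; rewrite ocompE.
have [/eqP E|E] := boolP (w j == u (th j)); last first.
  apply: val_inj; rewrite /= insert_one_eq ?(wP _ E).2 //.
  by rewrite mk_ordmapE (negbTE E) inordK.
by rewrite mk_ordmapE E eqxx Eu ocompE.
Qed.

End Extend.

Lemma filling (G0 : graph Y A) : partial_map G0 -> saturated G0 ->
  (forall n (x : M n) (s : ordmap n 2), in_horn (inord 1 : 'I_3) s ->
     @graph_dom Y A G0 n (x, s)) ->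
  exists g : smap Y A, forall n (y : Y n) a, graph_rel G0 y a -> g n y = a.
Proof.
move=> G0p G0s G0h.
(* Taking the union with [G0] gives the empty chain an upper bound as well. *)
pose P : set (graph Y A) :=
  [set G | partial_map (G0 `|` G) /\ saturated (G0 `|` G)].
have P0 : P set0 by rewrite /P /= setU0.
have [F FP Ftot|G [[Gp Gs] Gmax]] := @Zorn_bigcup _ P.
  pose U := \bigcup_(X in F) X.
  have one p : (G0 `|` U) p -> exists X, [/\ P X, X `<=` U & (G0 `|` X) p].
    case=> [p0|[X FX Xp]]; first by exists set0; split=> //; left.
    by exists X; split; [exact: FP|move=> q Xq; exists X|right].
  have two p q : (G0 `|` U) p -> (G0 `|` U) q ->
      exists X, [/\ P X, X `<=` U, (G0 `|` X) p & (G0 `|` X) q].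
    case=> [p0|[X FX Xp]] [q0|[X' FX' X'q]].
    - by exists set0; split=> //; left.
    - by exists X'; split; [exact: FP|move=> z ?; exists X'|left|right].
    - by exists X; split; [exact: FP|move=> z ?; exists X|right|left].
    - have [S|S] := Ftot _ _ FX FX'.
        by exists X'; split; [exact: FP|move=> z ?; exists X'|right; apply: S|right].
      by exists X; split; [exact: FP|move=> z ?; exists X|right|right; apply: S].
  split; first split.
  - move=> n y a b Ua Ub; have [X [[[Xp _] _] _ Xa Xb]] := two _ _ Ua Ub.
    exact: Xp Xa Xb.
  - move=> m n f y a Ua; have [X [[[_ Xp] _] XU Xa]] := one _ Ua.
    by apply: (setUS XU); exact: Xp.
  - move=> n x s l ls [a Ua] p th w Hw; have [X [[_ Xs] XU Xa]] := one _ Ua.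
    have [b Xb] : @graph_dom Y A (G0 `|` X) p (act th x, w).
      by apply: (Xs _ _ _ _ ls _ _ _ _ Hw); exists a.
    by exists b; apply: (setUS XU).
set H := G0 `|` G in Gp Gs.
have Hh n (x : M n) (s : ordmap n 2) : in_horn (inord 1 : 'I_3) s ->
    @graph_dom Y A H n (x, s).
  by move=> /(G0h _ x)[a Ga]; exists a; left.
have Hdom n : forall (x : M n) (s : ordmap n 2), @graph_dom Y A H n (x, s).
  elim/ltn_ind: n => n IHn.
  (* Lexicographic induction on [n] and [l] provides the hypotheses [dimG] and [rankG]; a simplex
     outside the domain would contradict maximality. *)
  have Hl : forall (l : nat) (x : M n) s (l' : 'I_n.+1),
      last_zero s l' -> l' = l :> nat -> l < n -> @graph_dom Y A H n (x, s).
    elim/ltn_ind => l IHl x s l' ls l'E ln.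
    apply: contrapT => nxs.
    have [|m x' s' mn|x' s' l1 l1s l1l|G' [G'p G's HG' G'xs]] :=
        @extend_filling H Gp Gs Hh n x s l' ls _ _ _ nxs.
    - by rewrite l'E.
    - exact: IHn.
    - apply: (IHl l1 _ _ _ _ l1s) => //; rewrite l'E in l1l => //.
      exact: ltn_trans ln.
    have E : G0 `|` G' = G' by apply/setUidPr => p p0; apply: HG'; left.
    have PG' : P G' by rewrite /P /= E.
    case: (Gmax G' _ PG').
    split; first by move=> p Gp'; apply: HG'; right.
    by move=> G'G; apply: nxs; case: G'xs => a /G'G; exists a; right.
  move=> x s; have [sh|sh] := boolP (in_horn (inord 1 : 'I_3) s); first exact: Hh.
  have [l ls ln] := last_zeroP sh; exact: Hl ls (erefl _) ln.
have Hex n (y : Y n) : graph_dom H y by case: y => x s; exact: Hdom.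
pose h n (y : Y n) := projT1 (cid (Hex n y)).
have hP n (y : Y n) : graph_rel H y (h n y) := projT2 (cid (Hex n y)).
have hM m n (f : ordmap m n) (y : Y n) : h m (act f y) = act f (h n y).
  by apply: Gp.1 (hP _ _) _; apply: Gp.2; exact: hP.
exists (SMap hM) => n y a ya; apply: Gp.1 (hP _ _) _; by left.
Qed.

End Filling.

(** * Exponentials *)

Section PrismMap.
Variables (p q n : nat) (phi : nat -> nat -> nat).
Hypothesis phiP : forall a a' b b',
  a <= a' <= p -> b <= b' <= q -> phi a b <= phi a' b' <= n.

Lemma prism_map_subproof m (u : ordmap m p) (v : ordmap m q) (i j : 'I_m.+1) :
  i <= j -> (inord (phi (u i) (v i)) : 'I_n.+1) <=
            (inord (phi (u j) (v j)) : 'I_n.+1).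
Proof.
move=> ij; have /andP[H Hn] : phi (u i) (v i) <= phi (u j) (v j) <= n.
  by apply: phiP; rewrite ordmap_homo //= -ltnS.
by rewrite !inordK //; lia.
Qed.

Definition prism_fun m (x : sprod (simplex p) (simplex q) m) : ordmap m n :=
  mk_ordmap (prism_map_subproof x.1 x.2).

Lemma prism_funE m x i :
  @prism_fun m x i = phi ((x.1 : ordmap m p) i) ((x.2 : ordmap m q) i) :> nat.
Proof.
rewrite mk_ordmapE inordK // ltnS.
pose u : ordmap m p := x.1; pose v : ordmap m q := x.2.
have /andP[] // : phi (u i) (v i) <= phi (u i) (v i) <= n.
by apply: phiP; rewrite leqnn -ltnS ltn_ord.
Qed.

Lemma prism_fun_act l m (f : ordmap l m) x :
  prism_fun (act f x) = ocomp (prism_fun x) f.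
Proof. by apply: ordmap_eqn => i; rewrite /= ocompE !prism_funE /= !ocompE. Qed.

Definition prism_map : smap (sprod (simplex p) (simplex q)) (simplex n) :=
  @SMap (sprod _ _) (simplex n) prism_fun prism_fun_act.

End PrismMap.

Lemma cut_subproof k n a b : a <= b <= n ->
  (k <= a) + (k < a) <= (k <= b) + (k < b) <= 2.
Proof. lia. Qed.
(** The vertices below, at and above [k] go to 0, 1 and 2. *)
Definition cut n k : ordmap n 2 := nat_ordmap (@cut_subproof k n).

Definition retr_fun k a b :=
  match b with 0 => minn a k | 1 => k | _ => maxn a k end.
Lemma retr_subproof n (k : 'I_n.+1) a a' b b' : a <= a' <= n -> b <= b' <= 2 ->
  retr_fun k a b <= retr_fun k a' b' <= n.
Proof.
move=> aa; have := ltn_ord k; case: b b' => [|[|b]] [|[|b']] //=; lia.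
Qed.
(* With [cut] this exhibits Lambda^n_k -> Delta^n as a retract of its
   pushout-product with Lambda^2_1 -> Delta^2. *)
Definition retr n (k : 'I_n.+1) : smap (sprod (simplex n) (simplex 2)) (simplex n) :=
  prism_map (@retr_subproof n k).

Lemma retr_cut n (k : 'I_n.+1) m (s : ordmap m n) :
  retr k m (s, ocomp (cut n k) s) = s.
Proof.
apply: ordmap_eqn => i; rewrite prism_funE /= ocompE nat_ordmapE /retr_fun.
by case: (ltngtP k (s i)) => //= H; lia.
Qed.

(** If [v] misses 0, all values are at least [k] and vertex 0 is missed; if [v] misses 2, all values
    are at most [k] and vertex [n] is missed. Here the horn has to be inner. *)
Lemma retr_horn n (k : 'I_n.+1) m (u : ordmap m n) (v : ordmap m 2) :
  0 < k < n -> in_horn (inord 1 : 'I_3) v -> in_horn k (retr k m (u, v)).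
Proof.
move=> hk /in_hornP[i i1 vi]; apply/in_hornP.
have {}i1 : i <> 1 :> nat.
  by move=> E; case/eqP: i1; apply: val_inj; rewrite /= inordK.
have [i0|i0] := eqVneq (i : nat) 0.
  exists ord0; first by rewrite -val_eqE /=; lia.
  move=> j; rewrite -val_eqE /= prism_funE /=.
  by have := vi j; rewrite -val_eqE /= i0; case: (v j : nat) => [|[|b]] //= _; lia.
exists ord_max; first by rewrite -val_eqE /=; lia.
move=> j; rewrite -val_eqE /= prism_funE /=; have := ltn_ord i.
have := vi j; have := ltn_ord (v j); rewrite -val_eqE /=.
by case: (v j : nat) => [|[|b]] //= *; lia.
Qed.

(** Row 1 is sent to [k], so the vertices inserted by [w] cannot hit the missed vertex, which
    differs from [k]. *)
Lemma retr_saturated n (k : 'I_n.+1) p m (u : ordmap m n) (v : ordmap m 2) l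
    (th : ordmap p m) (w : ordmap p 2) :
  (forall j, w j = v (th j) \/ th j = l /\ w j = 1 :> nat) ->
  in_horn k (retr k m (u, v)) -> in_horn k (retr k p (ocomp u th, w)).
Proof.
move=> Hw /in_hornP[i ik H]; apply/in_hornP; exists i => // j.
case: (Hw j) => [E|[_ E]].
  by have := H (th j); rewrite -!val_eqE /= !prism_funE /= ocompE E.
by rewrite -val_eqE /= prism_funE /= E /= eq_sym.
Qed.

Theorem ihom_quasicategory (K A : sset) :
  quasicategory A -> quasicategory (ihom K A).
Proof.
move=> hA n k hk f.
pose M := sprod K (simplex n); pose Y := sprod M (simplex 2).
pose rt m (y : Y m) : ordmap m n := retr k m (y.1.2, y.2).
have rtM l m (t : ordmap l m) (y : Y m) : rt l (act t y) = ocomp (rt m y) t.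
  exact: (smapP (retr k) t (y.1.2, y.2)).
(* Where the retraction lands in the horn, [f] prescribes a value; evaluating at [oid m] uncurries
   it. *)
pose val_at m (y : Y m) (h : in_horn k (rt m y)) : A m :=
  f m (exist _ (rt m y) h) m (y.1.1, oid m).
pose G : graph Y A := fun p =>
  exists h : in_horn k (rt _ (projT2 p).1), (projT2 p).2 = val_at _ _ h.
have Gdom m (y : Y m) : in_horn k (rt m y) -> graph_dom G y.
  by move=> h; exists (val_at _ _ h), h.
have [|||g Hg] := @filling M A hA G.
- split=> [m y a b [h /= ->] [h' /= ->]|l m t y a [h /= ->]].
    by rewrite (bool_irrelevance h h').
  have h' : in_horn k (rt l (act t y)) by rewrite rtM; exact: horn_subproof.
  exists h'; rewrite /= /val_at -smapP /= ocomp1l.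
  have -> : exist _ (rt l (act t y)) h' =
      act t (exist _ (rt m y) h : horn k m) :> horn k l.
    by apply: val_inj; exact: rtM.
  by rewrite smapP /= ocomp1r.
- move=> m [c u] v l _ [a [h _]] p th w Hw; apply: Gdom.
  exact: (retr_saturated Hw h).
- by move=> m x v vh; apply: Gdom; exact: retr_horn.
(* Restrict [g] along [cut]; by [retr_cut] this has the prescribed values on the horn. *)
pose F m (s : ordmap m n) p (x : sprod K (simplex m) p) : A p :=
  g p ((x.1, ocomp s x.2), ocomp (cut n k) (ocomp s x.2)).
have Fact m (s : ordmap m n) l p (t : ordmap l p) x :
    F m s l (act t x) = act t (F m s p x).
  by rewrite /F -smapP /= !ocompA.
pose F' m (s : simplex n m) : ihom K A m :=
  @SMap (sprod K (simplex m)) A (F m s) (Fact m s).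
have F'act l m (t : ordmap l m) s : F' l (act t s) = act t (F' m s).
  by apply: smap_eq => p [c q]; rewrite /= /F /= !ocompA.
exists (SMap F'act) => m s; apply: smap_eq => p [c q] /=; apply: Hg.
have rtE : rt p ((c, ocomp (val s) q), ocomp (cut n k) (ocomp (val s) q))
    = ocomp (val s) q by exact: retr_cut.
have h : in_horn k (ocomp (val s) q) by exact: horn_subproof (valP s).
have h' := h; rewrite -rtE in h'; exists h'; rewrite /= /val_at.
have -> : exist (fun s => in_horn k s) _ h' = act q s :> horn k p.
  by apply: val_inj; exact: rtE.
by rewrite smapP /= ocomp1r.
Qed.

(** * The homotopy category of a quasi-category *)

Lemma cofaceC n i j : i < j <= n.+2 ->
  ocomp (coface (inord j : 'I_n.+3)) (coface (inord i : 'I_n.+2)) =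
  ocomp (coface (inord i)) (coface (inord j.-1)).
Proof.
move=> ij; apply: ordmap_eqn => l; rewrite !ocompE !cofaceEn !inordK; lia.
Qed.

Lemma act_cofaceC (X : sset) n i j (T : X n.+2) : i < j <= n.+2 ->
  act (coface (inord i)) (act (coface (inord j)) T) =
  act (coface (inord j.-1)) (act (coface (inord i)) T).
Proof. by move=> ij; rewrite -!actM cofaceC. Qed.

Lemma coface_src : coface (inord 1) = oconst 0 v0.
Proof. by apply: ordmap_eqn => i; rewrite cofaceEn oconstE inordK // [i]ord1. Qed.
Lemma coface_tgt : coface (inord 0) = oconst 0 v1.
Proof. by apply: ordmap_eqn => i; rewrite cofaceEn oconstE inordK // [i]ord1. Qed.

Lemma neq_inord n i j : i <= n -> j <= n -> i != j ->
  (inord i : 'I_n.+1) != inord j.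
Proof. by move=> ? ? ?; rewrite -val_eqE /= !inordK. Qed.

Section QuasiHomotopy.
Variables (X : sset) (hX : quasicategory X).

Lemma compose_edges (x y z : X 0) (e01 : edge x y) (e12 : edge y z) :
  exists (e02 : edge x z) s, bounds s e01 e12 e02.
Proof.
(* Face 1 is the missing one, so the default branch matters only for face 2. *)
have [||s Hs] := @horn_filler X hX 0 (inord 1)
    _ (fun i => if i == 0 :> nat then edge_simp e12 else edge_simp e01).
- by rewrite inordK.
- move=> i j; rewrite -!val_eqE /= inordK //.
  have := ltn_ord j; case: (i : nat) => [|[|[|//]]];
    case: (j : nat) => [|[|[|//]]] //= _ _ _ _.
  by rewrite coface_src coface_tgt edge_src edge_tgt.
have s0 := Hs _ (@neq_inord 2 0 1 isT isT isT).
have s2 := Hs _ (@neq_inord 2 2 1 isT isT isT).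
rewrite !inordK // /= in s0 s2.
have src : act (oconst 0 v0) (act (coface (inord 1)) s) = x.
  by rewrite -coface_src -(@act_cofaceC _ 0 1 2) // s2 coface_src edge_src.
have tgt : act (oconst 0 v1) (act (coface (inord 1)) s) = z.
  by rewrite -coface_tgt (@act_cofaceC _ 0 0 1) // s0 coface_tgt edge_tgt.
by exists (Edge _ src tgt), s.
Qed.

Section Tetrahedron.
Variables (x0 x1 x2 x3 : X 0).
Variables (e01 : edge x0 x1) (e02 : edge x0 x2) (e03 : edge x0 x3).
Variables (e12 : edge x1 x2) (e13 : edge x1 x3) (e23 : edge x2 x3).

(** This fills Lambda^3_1, and [tetrahedron2] fills Lambda^3_2; the simplicial identities determine
    the boundary of the new face. *)
Lemma tetrahedron1 s3 s0 s2 :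
  bounds s3 e01 e12 e02 -> bounds s0 e12 e23 e13 -> bounds s2 e01 e13 e03 ->
  exists T : X 3, [/\ act (coface (inord 3)) T = s3, act (coface (inord 0)) T = s0,
    act (coface (inord 2)) T = s2 & bounds (act (coface (inord 1)) T) e02 e23 e03].
Proof.
move=> [a2 a0 a1] [b2 b0 b1] [c2 c0 c1].
have [||T HT] := @horn_filler X hX 1 (inord 1)
    _ (fun i => match (i : nat) with 0 => s0 | 2 => s2 | _ => s3 end).
- by rewrite inordK.
- move=> i j; rewrite -!val_eqE /= inordK //.
  have := ltn_ord j; case: (i : nat) => [|[|[|[|//]]]];
    case: (j : nat) => [|[|[|[|//]]]] //= _ _ _ _.
  + by rewrite c0 b1.
  + by rewrite a0 b2.
  + by rewrite a2 c2.
have T0 := HT _ (@neq_inord 3 0 1 isT isT isT).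
have T2 := HT _ (@neq_inord 3 2 1 isT isT isT).
have T3 := HT _ (@neq_inord 3 3 1 isT isT isT).
rewrite !inordK // /= in T0 T2 T3.
exists T; split=> //; split.
- by rewrite -(@act_cofaceC _ _ 1 3) // T3 a1.
- by rewrite act_cofaceC // T0 b0.
- by rewrite -(@act_cofaceC _ _ 1 2) // T2 c1.
Qed.

Lemma tetrahedron2 s3 s0 s1 :
  bounds s3 e01 e12 e02 -> bounds s0 e12 e23 e13 -> bounds s1 e02 e23 e03 ->
  exists T : X 3, [/\ act (coface (inord 3)) T = s3, act (coface (inord 0)) T = s0,
    act (coface (inord 1)) T = s1 & bounds (act (coface (inord 2)) T) e01 e13 e03].
Proof.
move=> [a2 a0 a1] [b2 b0 b1] [c2 c0 c1].
have [||T HT] := @horn_filler X hX 1 (inord 2)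
    _ (fun i => match (i : nat) with 0 => s0 | 1 => s1 | _ => s3 end).
- by rewrite inordK.
- move=> i j; rewrite -!val_eqE /= inordK //.
  have := ltn_ord j; case: (i : nat) => [|[|[|[|//]]]];
    case: (j : nat) => [|[|[|[|//]]]] //= _ _ _ _.
  + by rewrite c0 b0.
  + by rewrite a0 b2.
  + by rewrite a1 c2.
have T0 := HT _ (@neq_inord 3 0 2 isT isT isT).
have T1 := HT _ (@neq_inord 3 1 2 isT isT isT).
have T3 := HT _ (@neq_inord 3 3 2 isT isT isT).
rewrite !inordK // /= in T0 T1 T3.
exists T; split=> //; split.
- by rewrite -(@act_cofaceC _ _ 2 3) // T3 a2.
- by rewrite act_cofaceC // T0 b1.
- by rewrite act_cofaceC // T1 c1.
Qed.

End Tetrahedron.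

Lemma hedge_surj (x y : hcat X) (f : hom x y) :
  exists e : @edge X x y, f = hedge e.
Proof.
move: x y f; apply: hcat_ind => [x|x y z e f [e' ->]].
  by exists (degen_edge x); rewrite hedge_deg.
by have [d [s Hs]] := compose_edges e e'; exists d; rewrite (hedge_tri Hs).
Qed.

Section Push.
Variable a : X 0.

(** Composition with [e] as a relation between edges out of [a], which avoids choosing composites.
    It makes hX act on sets of edges, so that equalities in hX yield 2-simplices. *)
Definition push (x y : X 0) (e : edge x y) (P : edge a x -> Prop) (h : edge a y) :
    Prop := exists g s, P g /\ bounds s g e h.

(** The two inclusions are fillers of Lambda^3_2 and Lambda^3_1. *)
Lemma push_tri (x y z : X 0) s (e01 : edge x y) (e12 : edge y z) (e02 : edge x z) P :
  bounds s e01 e12 e02 -> push e12 (push e01 P) = push e02 P.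
Proof.
move=> Hs; apply/funext => k; apply/propext; split.
  case=> h [s2 [[g [s1 [Pg H1]]] H2]].
  by have [T [_ _ _ HT]] := tetrahedron2 H1 Hs H2; exists g, (act (coface (inord 2)) T).
case=> g [s2 [Pg H2]]; have [h [s1 H1]] := compose_edges g e01.
have [T [_ _ _ HT]] := tetrahedron1 H1 Hs H2.
by exists h, (act (coface (inord 1)) T); split=> //; exists g, s1.
Qed.

(** Invariance under homotopy makes the degenerate edge act as the identity. *)
Definition push_ob (x : X 0) : Type :=
  {P : edge a x -> Prop | push (degen_edge x) P = P}.

(* The objects are the points of [X] and not types, because the category of all
   types lives in a universe too large for the target of [hrec]. *)
Definition push_cat : category :=
  @Category (X 0) (fun x y => push_ob x -> push_ob y) (fun _ P => P)
    (fun _ _ _ f g P => g (f P))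
    (fun _ _ _ => erefl) (fun _ _ _ => erefl) (fun _ _ _ _ _ _ _ => erefl).

Definition push_hom (x y : X 0) (e : edge x y) : @hom push_cat x y :=
  fun P => exist _ (push e (sval P)) (push_tri (sval P) (codegen0_bounds e)).

Lemma push_deg x (e : edge x x) : degenerate e -> push_hom e = idm (x : push_cat).
Proof.
move=> He; have -> : e = degen_edge x by exact: edge_eq.
by apply/funext => -[P HP]; apply: eq_exist.
Qed.

Lemma push_homM x y z s (e01 : edge x y) (e12 : edge y z) (e02 : edge x z) :
  bounds s e01 e12 e02 -> push_hom e01 ;; push_hom e12 = push_hom e02.
Proof.
by move=> Hs; apply/funext => -[P HP]; apply: eq_exist; exact: push_tri Hs.
Qed.

Definition push_functor : functor (hcat X) push_cat :=
  @hrec X push_cat id push_hom push_deg push_homM.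

End Push.

(** Fill Lambda^3_1 on the vertices [x], [x], [y], [y]: the degenerate edge of the homotopy moves
    from the source to the target. *)
Lemma homotopy_flip (x y : X 0) (k e : edge x y) s :
  bounds s (degen_edge x) k e -> exists s', bounds s' k (degen_edge y) e.
Proof.
move=> Hs; have [T [_ _ _ HT]] :=
  tetrahedron1 (codegen1_bounds k) (codegen0_bounds k) Hs.
by exists (act (coface (inord 1)) T).
Qed.

(* Equal morphisms of the homotopy category act in the same way, through
   [push_functor x], on the homotopy class of the degenerate edge at [x]. *)
Lemma hedge_tri_inv (x y z : X 0) (e01 : edge x y) (e12 : edge y z)
    (e02 : edge x z) :
  hedge e01 ;; hedge e12 = hedge e02 -> exists s, bounds s e01 e12 e02.
Proof.
pose D := degen_edge x.
pose P0 : push_ob x x := exist _ (push D (eq D)) (push_tri _ (degen_bounds x)).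
move=> /(congr1 (fun f => sval (fhom (push_functor x) f P0) e02)).
rewrite fhomM !hrec_edge /= => E.
have : push e02 (push D (eq D)) e02.
  exists D, (act (codegen 1) (edge_simp e02)); split; last exact: codegen1_bounds.
  by exists D, (act (oconst 2 ord0) x); split=> //; exact: degen_bounds.
rewrite -E (push_tri _ (codegen1_bounds e01)).
case=> h [s2 [[_ [s1 [<- H1]]] H2]].
(* The witnesses make a composite [k] of [e01] and [e12] homotopic to [e02]; a last filler replaces
   [k] by [e02] as the long edge. *)
have [k [s3 H3]] := compose_edges e01 e12.
have [T [_ _ _ /homotopy_flip[s4 H4]]] := tetrahedron2 H1 H3 H2.
have [T' [_ _ _ HT']] := tetrahedron2 H3 (codegen0_bounds e12) H4.
by exists (act (coface (inord 2)) T').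
Qed.

End QuasiHomotopy.

(** * The weak cotensor *)

Lemma isom_right_inverses (C : category) (x y : C) (f : hom x y) (g : hom y x)
  (h : hom x y) : f ;; g = idm x -> g ;; h = idm y -> isom f.
Proof.
move=> fg gh; exists g; split=> //.
by have -> : f = h by rewrite -[f]compm1r -gh compmA fg compm1l.
Qed.

Lemma isom_left_inverses (C : category) (x y : C) (f : hom x y) (g : hom y x)
  (h : hom x y) : g ;; f = idm y -> h ;; g = idm x -> isom f.
Proof.
move=> gf hg; exists g; split=> //.
by have -> : f = h by rewrite -[f]compm1l -hg -compmA gf compm1r.
Qed.

Lemma isom_comp (C : category) (x y z : C) (f : hom x y) (g : hom y z) :
  isom f -> isom g -> isom (f ;; g).
Proof.
move=> [f' [ff' f'f]] [g' [gg' g'g]]; exists (g' ;; f'); split.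
  by rewrite compmA -(compmA f) gg' compm1r.
by rewrite compmA -(compmA g') f'f compm1r.
Qed.

Lemma isom_Arrow (C : category) (x y x' y' : C) (f : hom x y) (f' : hom x' y') :
  Arrow f = Arrow f' -> isom f -> isom f'.
Proof.
move=> E; move: (congr1 (@adom C) E) (congr1 (@acod C) E) => /= Ex Ey.
by subst x' y'; rewrite (Arrow_inj E).
Qed.

Lemma boundsP (X : sset) (s : X 2) :
  exists x y z (e01 : edge x y) (e12 : edge y z) (e02 : edge x z),
  bounds s e01 e12 e02.
Proof.
have h01 : (inord 0 : 'I_3) <= (inord 1 : 'I_3) by rewrite !inordK.
have h12 : (inord 1 : 'I_3) <= (inord 2 : 'I_3) by rewrite !inordK.
have := vedgeM s h01 h12; have -> : otri h01 h12 = oid 2.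
  apply: ordmap_eqn => i; rewrite mk_ordmapE oidE /otri_fun.
  by case: i => [[|[|[|//]]] ?] /=; rewrite inordK.
by rewrite act1; do 6!eexists; eassumption.
Qed.

(** [hprod] follows [b] and then [t]; a product of two degenerate triangles identifies this
    composite with the diagonal [pair_edge b t]. *)
Lemma hcomp_edge (X P A : sset) (p q : ihom P A 0) (f g : ihom X P 0)
    (b : edge p q) (t : edge f g) :
  fhom (hcomp X P A) (hpair (hedge b) (hedge t)) =
  hedge (smap_edge (icomp X P A) (pair_edge b t)).
Proof.
rewrite -[RHS](hmap_edge (icomp X P A)).
have E : hprod_hom (hpair (hedge b) (hedge t)) = hedge (pair_edge b t).
  rewrite /hprod_hom.
  rewrite (hrec_edge (@hinl_deg _ _ f) (@hinl_tri _ _ f)).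
  rewrite (hrec_edge (@hinr_deg _ _ q) (@hinr_tri _ _ q)).
  exact: hedge_tri (pair_bounds (codegen0_bounds b) (codegen1_bounds t)).
change (fhom (hmap (icomp X P A)) (hprod_hom (hpair (hedge b) (hedge t))) =
  fhom (hmap (icomp X P A)) (hedge (pair_edge b t))).
by rewrite E.
Qed.

(** * Simplices of the exponential as maps out of prisms *)

Section Cotensor.
Variables X A : sset.
Notation B := (ihom X A).
Notation Q := (ihom X (arrow_sset A)).
Notation prism n := (sprod (simplex 1) (simplex n)).

Definition pre (N N' : sset) (phi : smap N' N) (h : smap (sprod X N) A) :
    smap (sprod X N') A :=
  @SMap (sprod X N') A (fun m x => h m (x.1, phi m x.2))
    (fun m n f x => etrans (congr1 (fun y => h m (act f x.1, y)) (smapP phi f x.2))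
       (smapP h f (x.1, phi n x.2))).

Program Definition curry n (h : smap (sprod X (prism n)) A) : Q n :=
  @SMap (sprod X (simplex n)) (arrow_sset A)
    (fun m x => @SMap (prism m) A
       (fun p y => h p (act y.2 x.1, (y.1, ocomp x.2 y.2))) _) _.
Next Obligation. by rewrite -smapP /= actM ocompA. Qed.
Next Obligation.
by apply: smap_eq => p [r q] /=; rewrite actM ocompA.
Qed.

Lemma uncurry_subproof n (u : Q n) l m (f : ordmap l m)
    (x : sprod X (prism n) m) :
  u l (act f x.1, act f x.2.2) l (act f x.2.1, oid l) =
  act f (u m (x.1, x.2.2) m (x.2.1, oid m)).
Proof.
rewrite -smapP /= -[(act f x.1, _)]/(act f ((x.1, x.2.2) : sprod X (simplex n) m)).
by rewrite smapP /= ocomp1l ocomp1r.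
Qed.

Definition uncurry n (u : Q n) : smap (sprod X (prism n)) A :=
  @SMap (sprod X (prism n)) A (fun m x => u m (x.1, x.2.2) m (x.2.1, oid m))
    (@uncurry_subproof n u).

Lemma curryK n (h : smap (sprod X (prism n)) A) : uncurry (curry h) = h.
Proof. by apply: smap_eq => m [x [r q]] /=; rewrite act1 ocomp1r. Qed.

Lemma uncurryK n (u : Q n) : curry (uncurry u) = u.
Proof.
apply: smap_eq => m [x s]; apply: smap_eq => p [r q] /=.
rewrite -[(act q x, ocomp s q)]/(act q ((x, s) : sprod X (simplex n) m)).
by rewrite smapP /= ocomp1r.
Qed.

Definition cell n k (phi : smap (prism n) (simplex k)) (s : B k) : Q n :=
  curry (pre phi s).

Lemma curry_act m n (f : ordmap m n) (h : smap (sprod X (prism n)) A)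
    (h' : smap (sprod X (prism m)) A) :
  (forall p x (r : ordmap p 1) (q : ordmap p m),
     h p (x, (r, ocomp f q)) = h' p (x, (r, q))) ->
  act f (curry h) = curry h'.
Proof.
move=> H; apply: smap_eq => l [x u]; apply: smap_eq => p [r q] /=.
by rewrite -H ocompA.
Qed.

Lemma cell_act n k k' m (phi : smap (prism n) (simplex k))
    (psi : smap (prism m) (simplex k')) (f : ordmap m n) (g : ordmap k' k) (s : B k) :
  (forall p (r : ordmap p 1) (q : ordmap p m),
     phi p (r, ocomp f q) = ocomp g (psi p (r, q))) ->
  act f (cell phi s) = cell psi (act g s).
Proof.
by move=> H; apply: curry_act => p x r q; rewrite /= H.
Qed.

Lemma cone1_subproof n a a' b b' : a <= a' <= 1 -> b <= b' <= n ->
  a * b.+1 <= a' * b'.+1 <= n.+1.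
Proof. by case: a a' => [|[|a]] [|[|a']] //=; lia. Qed.
(* The first row is 0, ..., 0 and the second is 1, ..., n+1. *)
Definition cone1 n : smap (prism n) (simplex n.+1) := prism_map (@cone1_subproof n).

Definition cone2_fun n a b := if a == 0 then b else n.+1.
Lemma cone2_subproof n a a' b b' : a <= a' <= 1 -> b <= b' <= n ->
  cone2_fun n a b <= cone2_fun n a' b' <= n.+1.
Proof. by rewrite /cone2_fun; case: a a' => [|[|a]] [|[|a']] //=; lia. Qed.
(* The first row is 0, ..., n and the second is n+1, ..., n+1. *)
Definition cone2 n : smap (prism n) (simplex n.+1) := prism_map (@cone2_subproof n).

Lemma ord2_cases (i : 'I_2) : i = 0 :> nat \/ i = 1 :> nat.
Proof. by case: i => [[|[|//]] ?]; [left|right]. Qed.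

(** The cone point is vertex 0, hence the shift of the face index. *)
Lemma cone1_coface n i (T : B n.+2) : i <= n.+1 ->
  act (coface (inord i)) (cell (cone1 n.+1) T) =
  cell (cone1 n) (act (coface (inord i.+1)) T).
Proof.
move=> hi; apply: cell_act => p r q; apply: ordmap_eqn => j.
rewrite ocompE cofaceEn !prism_funE /= ocompE cofaceEn !inordK; [|lia|lia].
by case: (ord2_cases (r j)) => ->; lia.
Qed.

Lemma cone2_coface n i (T : B n.+2) : i <= n.+1 ->
  act (coface (inord i)) (cell (cone2 n.+1) T) =
  cell (cone2 n) (act (coface (inord i)) T).
Proof.
move=> hi; apply: cell_act => p r q; apply: ordmap_eqn => j.
rewrite ocompE cofaceEn !prism_funE /= ocompE cofaceEn !inordK; [|lia|lia].
rewrite /cone2_fun; have := ltn_ord (q j).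
by case: (ord2_cases (r j)) => -> /=; lia.
Qed.

Lemma codegenE k i : codegen k i = (k < i) :> nat.
Proof. by rewrite mk_ordmapE; case: ifP. Qed.

Lemma cone1_degenerate (s : B 1) :
  cell (cone1 1) (act (codegen 0) s) = act (oconst 1 ord0) (cell (cone1 0) s).
Proof.
symmetry; apply: cell_act => p r q; apply: ordmap_eqn => j.
rewrite ocompE codegenE !prism_funE /= ocompE oconstE /=.
by case: (ord2_cases (r j)) => ->; lia.
Qed.

Lemma cone2_degenerate (s : B 1) :
  cell (cone2 1) (act (codegen 1) s) = act (oconst 1 ord0) (cell (cone2 0) s).
Proof.
symmetry; apply: cell_act => p r q; apply: ordmap_eqn => j.
rewrite ocompE codegenE !prism_funE /= ocompE oconstE /cone2_fun /=.
by have := ltn_ord (q j); case: (ord2_cases (r j)) => -> /=; lia.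
Qed.

Hypothesis hB : quasicategory B.

Lemma isom_hedgeP (x y : B 0) (u : edge x y) :
  isom (hedge u : @hom (hcat B) x y) ->
  exists (v : edge y x) s t, bounds s u v (degen_edge x) /\
    bounds t v u (degen_edge y).
Proof.
case=> g [gu ug]; have [v E] := hedge_surj hB g; subst g.
have D z : idm (z : hcat B) = hedge (degen_edge z) by rewrite hedge_deg.
rewrite !D in gu ug; have [s Hs] := hedge_tri_inv hB gu.
by have [t Ht] := hedge_tri_inv hB ug; exists v, s, t.
Qed.

Lemma isom_inverse (x y : B 0) (u : edge x y) (v : edge y x) s t :
  bounds s u v (degen_edge x) -> bounds t v u (degen_edge y) ->
  isom (hedge v : @hom (hcat B) y x).
Proof.
move=> Hs Ht; exists (hedge u).
by rewrite (hedge_tri Hs) (hedge_tri Ht) !hedge_deg.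
Qed.

(** Fill Lambda^3_1 with [s], a triangle for [u ;; v = 1] and a degenerate one. The cone on the
    filler is a triangle of [Q] with short edges [e], [e'] and degenerate long edge. As [e'] has the
    same shape, the lemma can be iterated. *)
Lemma cone1_inverse x y z s (e01 : edge x y) (u : edge y z) (e02 : edge x z)
    (f d : Q 0) (e : edge f d) :
  bounds s e01 u e02 -> isom (hedge u : @hom (hcat B) y z) ->
  edge_simp e = cell (cone1 1) s ->
  exists s' (v : edge z y) (e' : edge d f),
    [/\ bounds s' e02 v e01, isom (hedge v : @hom (hcat B) z y),
     edge_simp e' = cell (cone1 1) s' &
     hedge e ;; hedge e' = idm (f : hcat Q)].
Proof.
move=> Hs /isom_hedgeP[v [s1 [s2 [H1 H2]]]] Ee.
have [T [T3 T0 T2 HT]] := tetrahedron1 hB Hs H1 (codegen0_bounds e01).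
have [a2 a0 a1] := Hs; have [b2 b0 b1] := HT.
have Ef : f = cell (cone1 0) (edge_simp e01).
  by rewrite -(edge_src e) Ee -coface_src cone1_coface // a2.
have Ed : d = cell (cone1 0) (edge_simp e02).
  by rewrite -(edge_tgt e) Ee -coface_tgt cone1_coface // a1.
set s' := act (coface (inord 1)) T in HT b2 b0 b1.
have src : act (oconst 0 v0) (cell (cone1 1) s') = d.
  by rewrite -coface_src cone1_coface // b2.
have tgt : act (oconst 0 v1) (cell (cone1 1) s') = f.
  by rewrite -coface_tgt cone1_coface // b1.
exists s', v, (Edge _ src tgt); split=> //; first exact: isom_inverse H1 H2.
rewrite -[RHS](hedge_deg (e := degen_edge f)) //.
apply: (@hedge_tri _ _ _ _ (cell (cone1 2) T)); split; rewrite cone1_coface //.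
- by rewrite T3 Ee.
- by rewrite T2 cone1_degenerate -Ef.
Qed.

(** Dually, the cone point is the last vertex, Lambda^3_2 is filled, and the inverse is on the other
    side. *)
Lemma cone2_inverse x y z s (u : edge x y) (e12 : edge y z) (e02 : edge x z)
    (d g : Q 0) (e : edge d g) :
  bounds s u e12 e02 -> isom (hedge u : @hom (hcat B) x y) ->
  edge_simp e = cell (cone2 1) s ->
  exists s' (v : edge y x) (e' : edge g d),
    [/\ bounds s' v e02 e12, isom (hedge v : @hom (hcat B) y x),
     edge_simp e' = cell (cone2 1) s' &
     hedge e' ;; hedge e = idm (g : hcat Q)].
Proof.
move=> Hs /isom_hedgeP[v [s1 [s2 [H1 H2]]]] Ee.
have [T [T3 T0 T1 HT]] := tetrahedron2 hB H2 Hs (codegen1_bounds e12).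
have [a2 a0 a1] := Hs; have [b2 b0 b1] := HT.
have Ed : d = cell (cone2 0) (edge_simp e02).
  by rewrite -(edge_src e) Ee -coface_src cone2_coface // a1.
have Eg : g = cell (cone2 0) (edge_simp e12).
  by rewrite -(edge_tgt e) Ee -coface_tgt cone2_coface // a0.
set s' := act (coface (inord 2)) T in HT b2 b0 b1.
have src : act (oconst 0 v0) (cell (cone2 1) s') = g.
  by rewrite -coface_src cone2_coface // b1.
have tgt : act (oconst 0 v1) (cell (cone2 1) s') = d.
  by rewrite -coface_tgt cone2_coface // b0.
exists s', v, (Edge _ src tgt); split=> //; first exact: isom_inverse H1 H2.
rewrite -[RHS](hedge_deg (e := degen_edge g)) //.
apply: (@hedge_tri _ _ _ _ (cell (cone2 2) T)); split; rewrite cone2_coface //.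
- by rewrite T0 Ee.
- by rewrite T1 cone2_degenerate -Eg.
Qed.

Lemma isom_edge_simp (Z : sset) (x y x' y' : Z 0) (u : edge x y) (u' : edge x' y') :
  edge_simp u = edge_simp u' ->
  isom (hedge u : @hom (hcat Z) x y) -> isom (hedge u' : @hom (hcat Z) x' y').
Proof. by move=> E; apply: isom_Arrow; exact: Arrow_hedge. Qed.

Lemma cone1_isom s y z (u : edge y z) (f d : Q 0) (e : edge f d) :
  act (coface (inord 0)) s = edge_simp u -> isom (hedge u : @hom (hcat B) y z) ->
  edge_simp e = cell (cone1 1) s -> isom (hedge e : @hom (hcat Q) f d).
Proof.
move=> su iu Ee.
have [x [y' [z' [e01 [u' [e02 Hs]]]]]] := boundsP s.
have iu' : isom (hedge u' : @hom (hcat B) y' z').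
  by apply: (isom_edge_simp _ iu); case: Hs => _ <- _.
have [s' [v [e' [Hs' iv Ee' ee']]]] := cone1_inverse Hs iu' Ee.
have [s'' [w [e'' [_ _ _ e'e'']]]] := cone1_inverse Hs' iv Ee'.
exact: isom_right_inverses ee' e'e''.
Qed.

Lemma cone2_isom s x y (u : edge x y) (d g : Q 0) (e : edge d g) :
  act (coface (inord 2)) s = edge_simp u -> isom (hedge u : @hom (hcat B) x y) ->
  edge_simp e = cell (cone2 1) s -> isom (hedge e : @hom (hcat Q) d g).
Proof.
move=> su iu Ee.
have [x' [y' [z [u' [e12 [e02 Hs]]]]]] := boundsP s.
have iu' : isom (hedge u' : @hom (hcat B) x' y').
  by apply: (isom_edge_simp _ iu); case: Hs => <- _ _.
have [s' [v [e' [Hs' iv Ee' e'e]]]] := cone2_inverse Hs iu' Ee.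
have [s'' [w [e'' [_ _ _ e''e']]]] := cone2_inverse Hs' iv Ee'.
exact: isom_left_inverses e'e e''e'.
Qed.

(** * Splitting a square along its diagonal *)

Definition slice i n : smap (simplex n) (prism n) :=
  @SMap (simplex n) (prism n) (fun m s => (oconst m i, s))
    (fun l m f s => congr1 (pair^~ (ocomp s f)) (esym (ocomp_constl i f))).

Definition bottom : smap (simplex 1) (prism 0) :=
  @SMap (simplex 1) (prism 0) (fun m s => (s, oconst m ord0))
    (fun l m f s => congr1 (pair (ocomp s f)) (esym (ocomp_constl ord0 f))).

(** [path 0 1] and [path 1 0] are the nondegenerate triangles of the square, through (1, 0) and (0,
    1) respectively. *)
Definition path k k' : smap (simplex 2) (prism 1) :=
  @SMap (simplex 2) (prism 1)
    (fun m s => (ocomp (codegen k) s, ocomp (codegen k') s))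
    (fun l m f s => congr2 pair (ocompA _ s f) (ocompA _ s f)).

Lemma fold_subproof a a' b b' : a <= a' <= 1 -> b <= b' <= 2 ->
  (1 < a + b) <= (1 < a' + b') <= 1.
Proof. lia. Qed.

(* The rows of [fold] are 0, 0, 1 and 0, 1, 1: precomposition with [fold] splits
   a square along its diagonal. *)
Definition fold : smap (prism 2) (simplex 1) := prism_map fold_subproof.

Definition fold_prism : smap (prism 2) (prism 1) :=
  @SMap (prism 2) (prism 1) (fun m y => (y.1, fold m y))
    (fun l m f y => congr1 (pair (ocomp y.1 f)) (smapP fold f y)).

(** Precomposition with [fold] turns [e] into a triangle [W] of [Q] whose face 1 is [e] and whose
    faces 2 and 0 are the two halves. *)
Lemma split_square (f g : Q 0) (e : edge f g) :
  let E := uncurry (edge_simp e) in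
  exists (d : Q 0) (e1 : edge f d) (e2 : edge d g),
  [/\ edge_simp e1 = cell (cone1 1) (pre (path 0 1) E),
      edge_simp e2 = cell (cone2 1) (pre (path 1 0) E) &
      hedge e1 ;; hedge e2 = hedge e].
Proof.
move=> E; pose W := curry (pre fold_prism E).
have [f' [d [g' [e1 [e2 [e' HW]]]]]] := boundsP W; have [W2 W0 W1] := HW.
have Ee : edge_simp e' = edge_simp e.
  rewrite -W1 -[RHS]uncurryK; apply: curry_act => p x r q /=.
  congr (E _ (_, (_, _))); apply: ordmap_eqn => j.
  rewrite prism_funE /= !ocompE cofaceEn inordK //.
  by case: (ord2_cases (r j)) => ->; case: (ord2_cases (q j)) => ->.
have Ef : f' = f by rewrite -(edge_src e') Ee edge_src.
have Eg : g' = g by rewrite -(edge_tgt e') Ee edge_tgt.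
subst f' g'; exists d, e1, e2; split.
- rewrite -W2; apply: curry_act => p x r q /=.
  congr (E _ (_, (_, _))); apply: ordmap_eqn => j; rewrite ?prism_funE /=
    !ocompE codegenE prism_funE /= ?cofaceEn ?inordK //;
  by case: (ord2_cases (r j)) => ->; case: (ord2_cases (q j)) => ->.
- rewrite -W0; apply: curry_act => p x r q /=.
  congr (E _ (_, (_, _))); apply: ordmap_eqn => j; rewrite ?prism_funE /=
    !ocompE codegenE prism_funE /= /cone2_fun ?cofaceEn ?inordK //;
  by case: (ord2_cases (r j)) => ->; case: (ord2_cases (q j)) => ->.
- by rewrite (hedge_tri HW); congr hedge; exact: edge_eq.
Qed.

Lemma ihom_simp_eq n (u v : B n) :
  (forall m x (s : ordmap m n), u m (x, s) = v m (x, s)) -> u = v.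
Proof. by move=> H; apply: smap_eq => m [x s]; exact: H. Qed.

Lemma lower_side (E : smap (sprod X (prism 1)) A) :
  act (coface (inord 0)) (pre (path 0 1) E : B 2) = pre (slice v1 1) E.
Proof.
apply: ihom_simp_eq => m x s /=; congr (E _ (_, (_, _))); apply: ordmap_eqn => j;
  rewrite !ocompE codegenE cofaceEn inordK //= ?oconstE //.
by case: (ord2_cases (s j)) => ->.
Qed.

Lemma upper_side (E : smap (sprod X (prism 1)) A) :
  act (coface (inord 2)) (pre (path 1 0) E : B 2) = pre (slice v0 1) E.
Proof.
apply: ihom_simp_eq => m x s /=; congr (E _ (_, (_, _))); apply: ordmap_eqn => j;
  rewrite !ocompE codegenE cofaceEn inordK //= ?oconstE //=;
  by case: (ord2_cases (s j)) => ->.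
Qed.

Lemma isom_square (f g : Q 0) (e : edge f g) (x y x' y' : B 0)
    (u0 : edge x y) (u1 : edge x' y') :
  edge_simp u0 = pre (slice v0 1) (uncurry (edge_simp e)) ->
  edge_simp u1 = pre (slice v1 1) (uncurry (edge_simp e)) ->
  isom (hedge u0 : @hom (hcat B) x y) -> isom (hedge u1 : @hom (hcat B) x' y') ->
  isom (hedge e : @hom (hcat Q) f g).
Proof.
move=> E0 E1 i0 i1; have [d [e1 [e2 [H1 H2 <-]]]] := split_square e.
apply: (@isom_comp (hcat Q)).
  by apply: cone1_isom i1 H1; rewrite lower_side E1.
by apply: cone2_isom i0 H2; rewrite upper_side E0.
Qed.

(** * Gluing two triangles to a square *)

Section Glue.
Variables (s t : B 2).
Hypothesis st : act (coface (inord 1)) s = act (coface (inord 1)) t.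

Lemma label_subproof a a' b b' : a <= a' <= 1 -> b <= b' <= 1 ->
  a + b <= a' + b' <= 2.
Proof. lia. Qed.
Definition label : smap (prism 1) (simplex 2) := prism_map label_subproof.

Definition below m (y : prism 1 m) : bool :=
  [forall j, (y.2 : ordmap m 1) j <= (y.1 : ordmap m 1) j].

(** The vertices (0, 1) and (1, 0) are incomparable, so a simplex of the square cannot contain
    both. *)
Lemma belowN m (r q : ordmap m 1) : ~~ @below m (r, q) -> forall j, r j <= q j.
Proof.
rewrite negb_forall => /existsP[i] /=; rewrite -ltnNge => qr j.
have := ltn_ord (q i); have := ltn_ord (r j).
case: (leqP i j) => [ij|/ltnW ji].
  by have := ordmap_homo q ij; lia.
by have := ordmap_homo r ji; lia.
Qed.

Lemma glue_diagonal m x (r q : ordmap m 1) : r = q ->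
  s m (x, label m (r, q)) = t m (x, label m (r, q)).
Proof.
move=> <-; have -> : label m (r, r) = ocomp (coface (inord 1)) r.
  apply: ordmap_eqn => j; rewrite prism_funE /= ocompE cofaceEn inordK //.
  by case: (ord2_cases (r j)) => ->.
exact: (congr1 (fun u : B 1 => u m (x, r)) st).
Qed.

Definition glue_fun m (x : sprod X (prism 1) m) : A m :=
  (if below x.2 then s else t) m (x.1, label m x.2).

Lemma glue_above m x (r q : ordmap m 1) : (forall j, r j <= q j) ->
  @glue_fun m (x, (r, q)) = t m (x, label m (r, q)).
Proof.
move=> rq; rewrite /glue_fun /=; case: ifP => // /forallP qr.
apply: glue_diagonal; apply: ordmap_eqn => j; apply/eqP.
by rewrite eqn_leq rq; exact: qr.
Qed.

Lemma glue_below m x (r q : ordmap m 1) : (forall j, q j <= r j) ->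
  @glue_fun m (x, (r, q)) = s m (x, label m (r, q)).
Proof. by move=> qr; rewrite /glue_fun /below /= (introT forallP qr). Qed.

(** A simplex above the diagonal may have a restriction on the diagonal, where [below] selects [s];
    [glue_above] covers this case too. *)
Lemma glue_act l m (f : ordmap l m) x (r q : ordmap m 1) :
  @glue_fun l (act f x, (ocomp r f, ocomp q f)) = act f (@glue_fun m (x, (r, q))).
Proof.
have E : label l (ocomp r f, ocomp q f) = ocomp (label m (r, q)) f.
  exact: (smapP label f (r, q)).
have [qr|nqr] := boolP (@below m (r, q)).
  have {}qr j : q j <= r j by exact: (forallP qr j).
  rewrite (glue_below x qr) glue_below; last by move=> j; rewrite !ocompE.
  by rewrite E -smapP.
have rq := belowN nqr.
rewrite (glue_above x rq) glue_above; last by move=> j; rewrite !ocompE.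
by rewrite E -smapP.
Qed.

Lemma glue_subproof l m (f : ordmap l m) (x : sprod X (prism 1) m) :
  glue_fun (act f x) = act f (glue_fun x).
Proof. by case: x => x [r q]; exact: glue_act. Qed.

Definition glue : smap (sprod X (prism 1)) A := SMap glue_subproof.

Lemma glue_lower m x (r : ordmap m 1) :
  glue m (x, (r, oconst m v0)) = (act (coface (inord 2)) s : B 1) m (x, r).
Proof.
rewrite /= glue_below => [|j]; last by rewrite oconstE.
congr (s _ (_, _)); apply: ordmap_eqn => j.
rewrite prism_funE /= ocompE cofaceEn inordK // oconstE /=.
by case: (ord2_cases (r j)) => ->.
Qed.

Lemma glue_right m x (q : ordmap m 1) :
  glue m (x, (oconst m v1, q)) = (act (coface (inord 0)) s : B 1) m (x, q).
Proof.
rewrite /= glue_below => [|j]; last by rewrite oconstE /= -ltnS.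
congr (s _ (_, _)); apply: ordmap_eqn => j.
by rewrite prism_funE /= ocompE cofaceEn inordK // oconstE /=.
Qed.

Lemma glue_left m x (q : ordmap m 1) :
  glue m (x, (oconst m v0, q)) = (act (coface (inord 2)) t : B 1) m (x, q).
Proof.
rewrite /= glue_above => [|j]; last by rewrite oconstE.
congr (t _ (_, _)); apply: ordmap_eqn => j.
rewrite prism_funE /= ocompE cofaceEn inordK // oconstE /=.
by case: (ord2_cases (q j)) => ->.
Qed.

Lemma glue_upper m x (r : ordmap m 1) :
  glue m (x, (r, oconst m v1)) = (act (coface (inord 0)) t : B 1) m (x, r).
Proof.
rewrite /= glue_above => [|j]; last by rewrite oconstE /= -ltnS.
congr (t _ (_, _)); apply: ordmap_eqn => j.
by rewrite prism_funE /= ocompE cofaceEn inordK // oconstE /= addn1.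
Qed.

End Glue.

Lemma fill_square (f g : Q 0) (x y x' y' : B 0) (a : edge x y) (b : edge x' y')
    (u0 : edge x x') (u1 : edge y y') :
  edge_simp a = pre bottom (uncurry f) -> edge_simp b = pre bottom (uncurry g) ->
  hedge a ;; hedge u1 = hedge u0 ;; hedge b ->
  exists e : edge f g,
    edge_simp u0 = pre (slice v0 1) (uncurry (edge_simp e)) /\
    edge_simp u1 = pre (slice v1 1) (uncurry (edge_simp e)).
Proof.
(* The diagonal [d] is a composite of [u0] and [b]; commutativity in hB then yields the second
   triangle on the same diagonal. *)
move=> Ea Eb sq; have [d [t Ht]] := compose_edges hB u0 b.
rewrite (hedge_tri Ht) in sq; have [s Hs] := hedge_tri_inv hB sq.
have [s2 s0 s1] := Hs; have [t2 t0 t1] := Ht.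
have st : act (coface (inord 1)) s = act (coface (inord 1)) t by rewrite s1 t1.
have src : act (oconst 0 v0) (curry (glue st)) = f.
  rewrite -[RHS]uncurryK; apply: curry_act => p c r q.
  by rewrite ocomp_constl glue_lower s2 Ea [in RHS](ordmap0E q ord0).
have tgt : act (oconst 0 v1) (curry (glue st)) = g.
  rewrite -[RHS]uncurryK; apply: curry_act => p c r q.
  by rewrite ocomp_constl glue_upper t0 Eb [in RHS](ordmap0E q ord0).
exists (Edge _ src tgt); rewrite /= curryK; split; apply: ihom_simp_eq => m c q.
  by rewrite /= -t2 -(glue_left st).
by rewrite /= -s0 -(glue_right st).
Qed.

End Cotensor.

(** This and [eval_arrow] express the values of the canonical functor by the uncurried square, in
    the form required by [fill_square] and [isom_square]. *)
Lemma eval_side (X A : sset) (i : 'I_2) (f g : ihom X (arrow_sset A) 0)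
    (e : edge f g) :
  edge_simp (smap_edge (icomp X (arrow_sset A) A)
    (pair_edge (degen_edge (cell1 (eval_at A i))) e)) =
  pre (slice i 1) (uncurry (edge_simp e)).
Proof. by apply: smap_eq => m [x s]. Qed.

Lemma eval_arrow (X A : sset) (f : ihom X (arrow_sset A) 0) :
  edge_simp (smap_edge (icomp X (arrow_sset A) A)
    (pair_edge (eval_edge A) (degen_edge f))) = pre bottom (uncurry f).
Proof.
by apply: smap_eq => m [x s] /=; rewrite (ordmap0E (ocomp _ s) ord0).
Qed.

Theorem proposition3p3p9 (A : sset) (hA : quasicategory A) :
  weak_cotensor_two (eval_2cell A).
Proof.
split; first exact: ihom_quasicategory.
move=> X _.
have hB : quasicategory (ihom X A) by exact: ihom_quasicategory.
have hQ : quasicategory (ihom X (arrow_sset A)) by do 2!apply: ihom_quasicategory.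
pose c := icomp X (arrow_sset A) A.
pose arr (f : ihom X (arrow_sset A) 0) :=
  smap_edge c (pair_edge (eval_edge A) (degen_edge f)).
pose side i (f g : ihom X (arrow_sset A) 0) (e : edge f g) :=
  smap_edge c (pair_edge (degen_edge (cell1 (eval_at A i))) e).
have arrE f : amor (whisker X (eval_2cell A) f) = hedge (arr f).
  by rewrite -(hcomp_edge (eval_edge A) (degen_edge f)) hedge_deg.
have sqdomE (f g : hom' X (arrow_sset A)) (e : edge f g) :
    sqdom (fhom (whisker X (eval_2cell A)) (hedge e)) = hedge (side v0 f g e).
  by rewrite -(hcomp_edge (degen_edge _) e) hedge_deg.
have sqcodE (f g : hom' X (arrow_sset A)) (e : edge f g) :
    sqcod (fhom (whisker X (eval_2cell A)) (hedge e)) = hedge (side v1 f g e).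
  by rewrite -(hcomp_edge (degen_edge _) e) hedge_deg.
split.
- case=> x y h; have [b ->] := hedge_surj hB h.
  (* The edge [b] becomes an object of hom'(X, A^2) through the projection of Delta^1 x Delta^0 to
     Delta^1. *)
  exists (curry (pre (spr1 (simplex 1) (simplex 0)) (edge_simp b))).
  rewrite [LHS](_ : _ = Arrow (hedge (arr (curry
    (pre (spr1 (simplex 1) (simplex 0)) (edge_simp b)))))).
    by apply: Arrow_hedge; rewrite eval_arrow curryK; apply: smap_eq => m [u s].
  by rewrite -arrE.
- move=> f g [u0 u1 sq].
  have [e0 E0] := hedge_surj hB u0; have [e1 E1] := hedge_surj hB u1.
  subst u0 u1.
  have sq' : hedge (arr f) ;; hedge e1 = hedge e0 ;; hedge (arr g).
    by rewrite -!arrE.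
  have [e [H0 H1]] := fill_square hB (eval_arrow f) (eval_arrow g) sq'.
  exists (hedge e); apply: square_eq.
    by rewrite sqdomE; congr hedge; apply: edge_eq; rewrite eval_side H0.
  by rewrite sqcodE; congr hedge; apply: edge_eq; rewrite eval_side H1.
- move=> f g t; have [e ->] := hedge_surj hQ t.
  case=> [w [tw wt]].
  apply: (@isom_square X A hB f g e _ _ _ _ (side v0 f g e) (side v1 f g e)).
  + exact: eval_side.
  + exact: eval_side.
  + exists (sqdom w); rewrite -sqdomE.
    by split; [exact: (congr1 (@sqdom _ _ _) tw)|exact: (congr1 (@sqdom _ _ _) wt)].
  + exists (sqcod w); rewrite -sqcodE.
    by split; [exact: (congr1 (@sqcod _ _ _) tw)|exact: (congr1 (@sqcod _ _ _) wt)].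
Qed.
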